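(* Let $n\in\mathbb{N}$ and let $\Gamma$ be a group satisfying $\mathsf{CERP}_{n+1}$ (the algebraic cheap equivariant $(n+1)$-rebuilding property). Let $\Lambda_*$ be a residual chain in $\Gamma$ and let $\alpha\colon\Gamma\curvearrowright(X,\mu)$ be the profinite completion of $\Gamma$ with respect to $\Lambda_*$. Let $Z$ be $\mathbb{Z}$ or a finite field. Then $$\mathrm{medim}^Z_r(\alpha)=0\quad\text{for all }r\in\{0,\dots,n+1\},$$ $$\mathrm{mevol}_r(\alpha)=0\quad\text{for all }r\in\{0,\dots,n\}.$$
   Context: $\mathbb{N}$ contains $0$. A residual chain $\Lambda_*=(\Lambda_i)_{i\in\mathbb{N}}$ in $\Gamma$ is a descending sequence of finite index normal subgroups with trivial intersection; the profinite completion with respect to it is the left translation action of $\Gamma$ on $\varprojlim_i\Gamma/\Lambda_i$ with the Haar probability measure. Cheap equivariant rebuilding. For $m\in\mathbb{N}$, $\Gamma$ satisfies $\mathsf{CERP}_m$ if there exist a free $\mathbb{Z}\Gamma$-resolution $C_*$ of $\mathbb{Z}$ with $C_j$ finitely generated for all $j\le m$ and $\kappa\in\mathbb{R}_{\ge1}$ such that for all $T\in\mathbb{R}_{\ge1}$ and every residual chain $\Lambda_*$ in $\Gamma$ there exists $i_0\in\mathbb{N}$ such that for all $i\ge i_0$ the $\mathbb{Z}\Lambda_i$-chain complex $\mathrm{Res}^{\mathbb{Z}\Gamma}_{\mathbb{Z}\Lambda_i}C_*$ is a $\mathbb{Z}\Lambda_i$-chain homotopy retract of a free $\mathbb{Z}\Lambda_i$-chain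 complex $E_*$, via $\mathbb{Z}\Lambda_i$-chain maps $f_*\colon\mathrm{Res}\,C_*\to E_*$, $g_*\colon E_*\to\mathrm{Res}\,C_*$ and a $\mathbb{Z}\Lambda_i$-chain homotopy $H_*\colon g_*\circ f_*\simeq\mathrm{id}$, satisfying for all $j\le m$: $\mathrm{rk}_{\mathbb{Z}\Lambda_i}(E_j)\le\frac{\kappa}{T}\,\mathrm{rk}_{\mathbb{Z}\Lambda_i}(\mathrm{Res}^{\mathbb{Z}\Gamma}_{\mathbb{Z}\Lambda_i}C_j)$ and $\|\partial^E_j\|,\|f_j\|,\|g_j\|,\|H_j\|\le\exp(\kappa)\cdot T^\kappa$. Here free modules are based and $\|\cdot\|$ is the operator norm with respect to the $\ell^1$-norms of the corresponding $\mathbb{Z}$-bases. $Z$ denotes $\mathbb{Z}$ with the usual absolute value or a finite field with the trivial norm ($|0|=0$, $|x|=1$ for $x\neq 0$). Standard actions. A standard $\Gamma$-action $\alpha\colon\Gamma\curvearrowright(X,\mu)$ is an essentially free, probability measure preserving action of a countable group on a standard Borel probability space. $L^\infty(\alpha,Z)=L^\infty(X,\mu,Z)$ is the ring of essentially bounded measurable functions $X\to Z$ modulo a.e. equality, with $(\gamma\cdot\lambda)(x)=\lambda(\gamma^{-1}x)$. The crossed product ring $R=L^\infty(\alpha,Z)*\Gamma$ is the free $L^\infty(\alpha,Z)$-module with basis $\Gamma$ (elements are finite sums of terms $(\lambda,\gamma)$) with multiplication $(\lambda,\gamma)(\lambda',\gamma')=(\lambda\cdot(\gamma\cdot\lambda'),\gamma\gamma')$.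 It contains $Z\Gamma$ via $\gamma\mapsto(1,\gamma)$ and acts on $L^\infty(\alpha,Z)$ by $(\lambda,\gamma)\cdot f=\lambda\cdot(\gamma\cdot f)$. Marked modules. For measurable $A\subset X$ put $\langle A\rangle=R\cdot(\chi_A,1)$. A marked projective $R$-module is an $R$-module $M$ with a finite family $(A_i)_{i\in I}$ of measurable subsets of $X$ and an isomorphism $M\cong\bigoplus_{i\in I}\langle A_i\rangle$ (suppressed from notation); $\dim_R(M)=\sum_i\mu(A_i)$. On $R$ let $|\sum_\gamma(\lambda_\gamma,\gamma)|_1=\sum_\gamma\int_X|\lambda_\gamma|\,d\mu$; elements of $M\subset\bigoplus_I R$ have norm $\|\sum_i\lambda_ie_i\|_1=\sum_i|\lambda_i|_1$. For an $R$-homomorphism $f\colon M\to N$ of marked projective modules, $\|f\|$ is the least $c$ with $\|f(z)\|_1\le c\|z\|_1$ for all $z$ (always finite). A marked direct summand of $\bigoplus_j\langle B_j\rangle$ is a submodule $\bigoplus_j\langle B_j'\rangle$ with $B_j'\subset B_j$ measurable. A finite marked decomposition of $M=\bigoplus_i\langle A_i\rangle$ is a finite family $(M_k)_k$ with $M_k=\bigoplus_i\langle A_{i,k}\rangle$ for measurable partitions $A_i=\bigsqcup_kA_{i,k}$. Logarithmic norm. $\log_+(t)=\max\{\log t,0\}$ (and $\log_+0=0$). $\mathrm{rk}(f)=\inf\{\dim N'\mid N'\subset N\text{ marked direct summand with }f(M)\subset N'\}$; $\mathrm{lognorm}'(f)=\min\{\dim(M)\log_+\|f\|,\ \mathrm{rk}(f)\log_+\|f\|\}$;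 $\mathrm{lognorm}(f)=\inf\sum_k\mathrm{lognorm}'(f|_{M_k}\colon M_k\to N)$, the infimum over all finite marked decompositions $(M_k)_k$ of $M$. Measured embeddings. A marked projective augmented $R$-chain complex $D_*\twoheadrightarrow L^\infty(\alpha,Z)$ is a chain complex $(D_k)_{k\ge0}$ of marked projective $R$-modules with a surjective $R$-homomorphism $\eta\colon D_0\to L^\infty(\alpha,Z)$, $\eta\circ\partial_1=0$. Fix a free $Z\Gamma$-resolution $C_*\twoheadrightarrow Z$ (the following is independent of the choice). An $\alpha$-embedding (up to degree $r$) is such a complex together with a $Z\Gamma$-chain map $C_*\to D_*$ up to degree $r+1$ extending the inclusion $Z\to L^\infty(\alpha,Z)$ as constant functions. $A_r(\alpha)$ is the class of all augmented complexes $D_*$ arising in this way. For $r\le n$: $\mathrm{medim}^Z_r(\alpha)=\inf_{D_*\in A_r(\alpha)}\dim_R(D_r)$, and (for $Z=\mathbb{Z}$) $\mathrm{mevol}_r(\alpha)=\inf_{D_*\in A_r(\alpha)}\mathrm{lognorm}(\partial^D_{r+1})$. In the boundary degree, $\mathrm{medim}^Z_{n+1}(\alpha)=\inf_{D_*\in A_n(\alpha)}\dim_R(D_{n+1})$. *)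

(* Defs.v *)
From HB Require Import structures.
From mathcomp Require Import all_boot all_order all_algebra finmap.
From mathcomp Require Import all_classical all_reals all_analysis.

Set Implicit Arguments.
Unset Strict Implicit.
Unset Printing Implicit Defensive.

Import Order.TTheory GRing.Theory Num.Theory.

Local Open Scope classical_set_scope.
Local Open Scope ring_scope.

Section FreeModule.
Variables (A : pzRingType) (I : choiceType).

Definition finitely_supported (x : I -> A^o) : bool :=
  `[< finite_set [set i | x i != 0] >].

Lemma finitely_supported_submod : submod_closed finitely_supported.
Proof.
split=> [|a x y /asboolP xf /asboolP yf]; apply/asboolP.
  by rewrite (_ : [set _ | _] = set0) //; apply/seteqP; split=> i //=; rewrite eqxx.
apply: (@sub_finite_set _ _ ([set i | x i != 0] `|` [set i | y i != 0])).
  move=> i /=; apply: contra_neqP => /not_orP[/negP/negPn/eqP xi /negP/negPn/eqP yi].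
  by change (a *: x i + y i = 0); rewrite xi yi scaler0 addr0.
by rewrite finite_setU.
Qed.

HB.instance Definition _ :=
  GRing.isSubmodClosed.Build A (I -> A^o) finitely_supported
    finitely_supported_submod.

Record freemod := FreeMod {
  fm_coef :> I -> A^o;
  fm_finP : finitely_supported fm_coef }.

HB.instance Definition _ := [isSub for fm_coef].
HB.instance Definition _ := [Choice of freemod by <:].
HB.instance Definition _ := [SubChoice_isSubLmodule of freemod by <:].

Lemma fmP (x y : freemod) : (forall i, x i = y i) -> x = y.
Proof. by move=> xy; apply/val_inj/funext. Qed.

Lemma fmD (x y : freemod) i : (x + y) i = x i + y i.
Proof. by []. Qed.

Lemma fmN (x : freemod) i : (- x) i = - x i.
Proof. by []. Qed.

Lemma fm0 i : (0 : freemod) i = 0.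
Proof. by []. Qed.

Lemma fmZ a (x : freemod) i : (a *: x) i = a * x i.
Proof. by []. Qed.

Definition delta_fun (i : I) (a : A) : I -> A^o := fun j => if j == i then a else 0.

Lemma delta_fun_finP i a : finitely_supported (delta_fun i a).
Proof.
apply/asboolP; apply: (@sub_finite_set _ _ [set i]) => // j /=.
by rewrite /delta_fun; case: (eqVneq j i) => //= _; rewrite eqxx.
Qed.

Definition delta i a : freemod := FreeMod (delta_fun_finP i a).

Lemma deltaE i a j : delta i a j = if j == i then a else 0.
Proof. by []. Qed.

Lemma deltaD i a b : delta i (a + b) = delta i a + delta i b.
Proof. by apply/fmP=> j; rewrite fmD !deltaE; case: ifP; rewrite ?addr0. Qed.

Lemma delta0 i : delta i 0 = 0.
Proof. by apply/fmP=> j; rewrite fm0 deltaE; case: ifP. Qed.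

(** Additive extension: [fm_ext phi (\sum_i a_i i) = \sum_i phi i a_i]. *)
Definition fm_ext (V : nmodType) (phi : I -> A -> V) (x : freemod) : V :=
  \sum_(i \in [set: I]) phi i (x i).

Definition fsupp (x : freemod) : {fset I} := fset_set [set i | x i != 0].

Lemma notin_fsupp x i : i \notin fsupp x -> x i = 0.
Proof.
rewrite in_fset_set; last exact/asboolP/fm_finP.
by move=> /negP ni; apply: contra_notP ni => /eqP xi; rewrite inE.
Qed.

Section Ext.
Variables (V : nmodType) (phi : I -> A -> V).
Hypothesis phi0 : forall i, phi i 0 = 0.
Hypothesis phiD : forall i a b, phi i (a + b) = phi i a + phi i b.

Lemma fm_ext_fset (S : {fset I}) (x : freemod) :
  (forall i, i \notin S -> x i = 0) -> fm_ext phi x = \sum_(i <- S) phi i (x i).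
Proof. by move=> xS; apply: fsbigTE => i /xS ->; rewrite phi0. Qed.

Lemma fm_extD x y : fm_ext phi (x + y) = fm_ext phi x + fm_ext phi y.
Proof.
set S := (fsupp x `|` fsupp y)%fset.
have xS i : i \notin S -> x i = 0.
  by rewrite in_fsetU negb_or => /andP[/notin_fsupp].
have yS i : i \notin S -> y i = 0.
  by rewrite in_fsetU negb_or => /andP[_ /notin_fsupp].
rewrite (fm_ext_fset xS) (fm_ext_fset yS) (@fm_ext_fset S).
  rewrite -big_split /=; apply: eq_bigr => i _; exact: phiD.
by move=> i iS; rewrite fmD xS // yS // addr0.
Qed.

Lemma fm_ext0 : fm_ext phi 0 = 0.
Proof. by rewrite (@fm_ext_fset fset0) // big_seq_fset0. Qed.

Lemma fm_ext_delta i a : fm_ext phi (delta i a) = phi i a.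
Proof.
rewrite (@fm_ext_fset [fset i]%fset) ?big_seq_fset1 ?deltaE ?eqxx // => j.
by rewrite in_fset1 => /negPf ji; rewrite deltaE ji.
Qed.

End Ext.

Lemma fm_decomp (x : freemod) : x = \sum_(i <- fsupp x) delta i (x i).
Proof.
apply/fmP=> j.
have E (r : seq I) : (\sum_(i <- r) delta i (x i) : freemod) j =
    \sum_(i <- r) (delta i (x i) j : A).
  by elim/big_rec2: _ => [|i a b _ <-]; rewrite ?fm0 ?fmD.
rewrite E; have [jx|jx] := boolP (j \in fsupp x); last first.
  rewrite notin_fsupp // big1_seq // => i /andP[_ ix]; rewrite deltaE.
  by case: eqP => // ji; rewrite ji ix in jx.
rewrite (big_fsetD1 j) // big1_seq => [|i /andP[_]]; first by rewrite deltaE eqxx; exact/esym/addr0.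
by rewrite in_fsetD1 deltaE eq_sym => /andP[/negPf ->].
Qed.

Lemma fm_ind (P : freemod -> Prop) :
  P 0 -> (forall x y, P x -> P y -> P (x + y)) -> (forall i a, P (delta i a)) ->
  forall x, P x.
Proof. by move=> P0 PD Pd x; rewrite [x]fm_decomp; elim/big_rec: _ => // *; apply: PD. Qed.

End FreeModule.

Arguments delta {A I}.
Arguments fm_ext {A I V}.

Record ring_action (G : groupType) (A : pzRingType) := RingAction {
  ra_act :> G -> {rmorphism A -> A};
  ra1 : forall a, ra_act 1%g a = a;
  raM : forall g h a, ra_act (g * h)%g a = ra_act g (ra_act h a) }.

(** The free left [A]-module with basis [G]; [delta g a] is the term [(a, g)]. *)
Definition crossed (G : groupType) (A : pzRingType) (al : ring_action G A) : Type :=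
  freemod A G.

(** The coefficient ring as a left module over the crossed product:
    [(a, g) . b = a * (g . b)]. *)
Definition coefmod (G : groupType) (A : pzRingType) (al : ring_action G A) : Type := A.

Section Crossed.
Variables (G : groupType) (A : pzRingType) (al : ring_action G A).

HB.instance Definition _ := GRing.Zmodule.on (crossed al).

Implicit Types x y z : crossed al.

Definition cp_one : crossed al := delta 1%g 1.

Definition cp_mul x y : crossed al :=
  fm_ext (fun g a => fm_ext (fun h b => delta (g * h)%g (a * al g b)) y) x.

Let inner g a y : freemod A G := fm_ext (fun h b => delta (g * h)%g (a * al g b)) y.

Let innerDr g a y z : inner g a (y + z) = inner g a y + inner g a z.
Proof.
apply: fm_extD => [h|h b c]; first by rewrite rmorph0 mulr0 delta0.
by rewrite rmorphD mulrDr deltaD.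
Qed.

Let inner0r g a : inner g a 0 = 0.
Proof. by apply: fm_ext0 => h; rewrite rmorph0 mulr0 delta0. Qed.

Let inner_delta g a h b : inner g a (delta h b) = delta (g * h)%g (a * al g b).
Proof. by apply: fm_ext_delta => k; rewrite rmorph0 mulr0 delta0. Qed.

Let innerDl g a b y : inner g (a + b) y = inner g a y + inner g b y.
Proof.
move: y; apply: fm_ind => [|y z|h c]; first by rewrite !inner0r addr0.
  by rewrite !innerDr => -> ->; rewrite addrACA.
by rewrite !inner_delta mulrDl deltaD.
Qed.

Let inner0l g y : inner g 0 y = 0.
Proof.
move: y; apply: fm_ind => [|y z|h c]; first by rewrite !inner0r.
  by rewrite innerDr => -> ->; rewrite addr0.
by rewrite inner_delta mul0r delta0.
Qed.

Lemma cp_mulDl x y z : cp_mul (x + y) z = cp_mul x z + cp_mul y z.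
Proof. by apply: fm_extD => *; [exact: inner0l|exact: innerDl]. Qed.

Lemma cp_mul0l z : cp_mul 0 z = 0.
Proof. by apply: fm_ext0 => *; exact: inner0l. Qed.

Lemma cp_mul_deltal g a y : cp_mul (delta g a) y = inner g a y.
Proof. by apply: fm_ext_delta => *; exact: inner0l. Qed.

Lemma cp_mul0r x : cp_mul x 0 = 0.
Proof.
move: x; apply: fm_ind => [|y z|h c]; first by rewrite cp_mul0l.
  by rewrite cp_mulDl => -> ->; rewrite addr0.
by rewrite cp_mul_deltal inner0r.
Qed.

Lemma cp_mulDr x y z : cp_mul x (y + z) = cp_mul x y + cp_mul x z.
Proof.
move: x; apply: fm_ind => [|u v|h c]; first by rewrite !cp_mul0l addr0.
  by rewrite !cp_mulDl => -> ->; rewrite addrACA.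
by rewrite !cp_mul_deltal innerDr.
Qed.

Lemma cp_mul_delta g a h b :
  cp_mul (delta g a) (delta h b) = delta (g * h)%g (a * al g b).
Proof. by rewrite cp_mul_deltal inner_delta. Qed.

Lemma cp_mulA x y z : cp_mul x (cp_mul y z) = cp_mul (cp_mul x y) z.
Proof.
move: x; apply: fm_ind => [|u v|g a]; first by rewrite !cp_mul0l.
  by rewrite !cp_mulDl => -> ->.
move: y; apply: fm_ind => [|u v|h b]; first by rewrite !(cp_mul0l, cp_mul0r).
  by rewrite !(cp_mulDr, cp_mulDl) => -> ->.
move: z; apply: fm_ind => [|u v|k c]; first by rewrite !cp_mul0r.
  by rewrite !cp_mulDr => -> ->.
by rewrite !cp_mul_delta mulgA rmorphM raM mulrA.
Qed.

Lemma cp_mul1l x : cp_mul cp_one x = x.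
Proof.
move: x; apply: fm_ind => [|u v|g a]; first by rewrite !cp_mul0r.
  by rewrite !cp_mulDr => -> ->.
by rewrite cp_mul_delta mul1g mul1r ra1.
Qed.

Lemma cp_mul1r x : cp_mul x cp_one = x.
Proof.
move: x; apply: fm_ind => [|u v|g a]; first by rewrite !cp_mul0l.
  by rewrite !cp_mulDl => -> ->.
by rewrite cp_mul_delta mulg1 rmorph1 mulr1.
Qed.

HB.instance Definition _ := GRing.Zmodule_isPzRing.Build (crossed al)
  cp_mulA cp_mul1l cp_mul1r cp_mulDl cp_mulDr.

HB.instance Definition _ := GRing.Zmodule.on (coefmod al).

Definition cp_scale x (b : coefmod al) : coefmod al := fm_ext (fun g a => a * al g b) x.

Lemma cp_scaleDl b x y : cp_scale (x + y) b = cp_scale x b + cp_scale y b.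
Proof. by apply: fm_extD => *; rewrite ?mul0r ?mulrDl. Qed.

Lemma cp_scale0l b : cp_scale 0 b = 0.
Proof. by apply: fm_ext0 => *; rewrite mul0r. Qed.

Lemma cp_scale_delta g a b : cp_scale (delta g a) b = a * al g b.
Proof. by apply: fm_ext_delta => *; rewrite mul0r. Qed.

Lemma cp_scaleDr x : {morph cp_scale x : b c / b + c}.
Proof.
move=> b c; move: x; apply: fm_ind => [|u v|g a].
- by rewrite !cp_scale0l addr0.
- by rewrite !cp_scaleDl => -> ->; rewrite addrACA.
- by rewrite !cp_scale_delta rmorphD mulrDr.
Qed.

Lemma cp_scaleA x y b : cp_scale x (cp_scale y b) = cp_scale (x * y) b.
Proof.
have s0 z : cp_scale z 0 = 0.
  by apply: (addrI (cp_scale z 0)); rewrite -cp_scaleDr !addr0.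
move: x; apply: fm_ind => [|u v|g a].
- by rewrite mul0r !cp_scale0l.
- by rewrite mulrDl !cp_scaleDl => -> ->.
move: y; apply: fm_ind => [|u v|h c].
- by rewrite mulr0 !cp_scale0l s0.
- by rewrite mulrDr !cp_scaleDl cp_scaleDr => -> ->.
have -> : (delta g a : crossed al) * delta h c = delta (g * h)%g (a * al g c).
  exact: cp_mul_delta.
by rewrite !cp_scale_delta rmorphM raM mulrA.
Qed.

Lemma cp_scale1 b : cp_scale 1 b = b.
Proof. by rewrite [LHS]cp_scale_delta mul1r ra1. Qed.

HB.instance Definition _ := GRing.Zmodule_isLmodule.Build (crossed al) (coefmod al)
  cp_scaleA cp_scale1 cp_scaleDr cp_scaleDl.

End Crossed.

Section CrossedMap.
Variables (G H : groupType) (A B : pzRingType).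
Variables (al : ring_action G A) (be : ring_action H B).

Record equivariant_pair := EquivariantPair {
  ep_ring : {rmorphism A -> B};
  ep_grp : G -> H;
  ep_grp1 : ep_grp 1%g = 1%g;
  ep_grpM : forall g h, ep_grp (g * h)%g = (ep_grp g * ep_grp h)%g;
  ep_equiv : forall g a, ep_ring (al g a) = be (ep_grp g) (ep_ring a) }.

Variable e : equivariant_pair.

(** The ring homomorphism [(a, g) |-> (ep_ring a, ep_grp g)]. *)
Definition crossed_map (x : crossed al) : crossed be :=
  fm_ext (fun g a => delta (ep_grp e g) (ep_ring e a)) x.

Lemma crossed_mapD x y : crossed_map (x + y) = crossed_map x + crossed_map y.
Proof. by apply: fm_extD => *; rewrite ?rmorph0 ?delta0 ?rmorphD ?deltaD. Qed.

Lemma crossed_map0 : crossed_map 0 = 0.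
Proof. by apply: fm_ext0 => *; rewrite ?rmorph0 ?delta0. Qed.

Lemma crossed_map_delta g a :
  crossed_map (delta g a) = delta (ep_grp e g) (ep_ring e a).
Proof. by apply: fm_ext_delta => *; rewrite ?rmorph0 ?delta0. Qed.

Lemma crossed_map_zmod : zmod_morphism crossed_map.
Proof.
move=> x y; rewrite crossed_mapD; congr (_ + _).
apply: (addIr (crossed_map y)).
by rewrite -crossed_mapD !addNr crossed_map0.
Qed.

Lemma crossed_map_monoid : monoid_morphism crossed_map.
Proof.
split; first by rewrite [LHS]crossed_map_delta ep_grp1 rmorph1.
have mulE (K : groupType) (C : pzRingType) (ga : ring_action K C) k c l d :
    (delta k c : crossed ga) * delta l d = delta (k * l)%g (c * ga k d).
  exact: cp_mul_delta.
move=> x y; move: x; apply: fm_ind => [|u v|g a].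
- by rewrite mul0r crossed_map0 mul0r.
- by rewrite mulrDl !crossed_mapD mulrDl => -> ->.
move: y; apply: fm_ind => [|u v|h b].
- by rewrite mulr0 crossed_map0 mulr0.
- by rewrite mulrDr !crossed_mapD mulrDr => -> ->.
by rewrite mulE !crossed_map_delta mulE ep_grpM rmorphM ep_equiv.
Qed.

HB.instance Definition _ :=
  GRing.isZmodMorphism.Build (crossed al) (crossed be) crossed_map crossed_map_zmod.
HB.instance Definition _ :=
  GRing.isMonoidMorphism.Build (crossed al) (crossed be) crossed_map
    crossed_map_monoid.

End CrossedMap.

Section GroupRing.
Variables (A : pzRingType) (G : groupType).

Definition trivial_action : ring_action G A :=
  @RingAction G A (fun=> idfun : {rmorphism A -> A}) (fun=> erefl) (fun _ _ _ => erefl).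

Definition group_ring := crossed trivial_action.
HB.instance Definition _ := GRing.PzRing.on group_ring.

Definition trivial_mod := coefmod trivial_action.
HB.instance Definition _ := GRing.Lmodule.on trivial_mod.

End GroupRing.

Definition resmod (S A : pzRingType) (phi : {rmorphism S -> A}) (M : lmodType A)
  : Type := M.

Section Restriction.
Variables (S A : pzRingType) (phi : {rmorphism S -> A}) (M : lmodType A).

HB.instance Definition _ := GRing.Zmodule.on (resmod phi M).

Definition res_scale (s : S) (m : resmod phi M) : resmod phi M := phi s *: (m : M).

Lemma res_scaleA a b m : res_scale a (res_scale b m) = res_scale (a * b) m.
Proof. by rewrite /res_scale rmorphM scalerA. Qed.

Lemma res_scale1 : left_id 1 res_scale.
Proof. by move=> m; rewrite /res_scale rmorph1 scale1r. Qed.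

Lemma res_scaleDr : right_distributive res_scale +%R.
Proof. by move=> a m p; rewrite /res_scale scalerDr. Qed.

Lemma res_scaleDl m : {morph res_scale^~ m : a b / a + b}.
Proof. by move=> a b; rewrite /res_scale rmorphD scalerDl. Qed.

HB.instance Definition _ := GRing.Zmodule_isLmodule.Build S (resmod phi M)
  res_scaleA res_scale1 res_scaleDr res_scaleDl.

End Restriction.

Record chain_complex (A : pzRingType) := ChainComplex {
  cc_mod :> nat -> lmodType A;
  cc_d : forall k, {linear cc_mod k.+1 -> cc_mod k};
  cc_dd : forall k x, cc_d k (cc_d k.+1 x) = 0 }.

Definition is_chain_map (A : pzRingType) (C D : chain_complex A)
    (f : forall k, {linear C k -> D k}) : Prop :=
  forall k (x : C k.+1), cc_d D k (f k.+1 x) = f k (cc_d C k x).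

(** [H] is a chain homotopy from [g \o f] to the identity of [C]; in degree [0]
    the summand through [C_{-1} = 0] is absent. *)
Definition is_homotopy_retract (A : pzRingType) (C E : chain_complex A)
    (f : forall k, {linear C k -> E k}) (g : forall k, {linear E k -> C k})
    (H : forall k, {linear C k -> C k.+1}) : Prop :=
  [/\ is_chain_map f, is_chain_map g,
      forall x : C 0%N, cc_d C 0%N (H 0%N x) = g 0%N (f 0%N x) - x &
      forall k (x : C k.+1),
        cc_d C k.+1 (H k.+1 x) + H k (cc_d C k x) = g k.+1 (f k.+1 x) - x].

Record based_complex (A : pzRingType) := BasedComplex {
  bc_basis : nat -> choiceType;
  bc_d : forall k,
    {linear freemod A (bc_basis k.+1) -> freemod A (bc_basis k)};
  bc_dd : forall k x, bc_d k (bc_d k.+1 x) = 0 }.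

Definition based_chain_complex (A : pzRingType) (C : based_complex A) :
    chain_complex A :=
  @ChainComplex A (fun k => freemod A (bc_basis C k)) (@bc_d A C) (@bc_dd A C).
Coercion based_chain_complex : based_complex >-> chain_complex.

Record free_resolution (Z : pzRingType) (G : groupType) := FreeResolution {
  fr_complex :> based_complex (group_ring Z G);
  fr_aug : {linear fr_complex 0%N -> trivial_mod Z G};
  fr_aug_surj : forall z, exists x, fr_aug x = z;
  fr_exact0 : forall x, fr_aug x = 0 <-> exists y, x = cc_d fr_complex 0%N y;
  fr_exactS : forall k x,
    cc_d fr_complex k x = 0 <-> exists y, x = cc_d fr_complex k.+1 y }.

Section RestrictComplex.
Variables (S A : pzRingType) (phi : {rmorphism S -> A}).

Section Map.
Variables (M N : lmodType A) (f : {linear M -> N}).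

Definition res_map : resmod phi M -> resmod phi N := f.

Lemma res_map_is_linear : linear res_map.
Proof. by move=> a x y; rewrite /res_map linearD linearZ. Qed.

HB.instance Definition _ :=
  GRing.isLinear.Build S (resmod phi M) (resmod phi N) *:%R res_map res_map_is_linear.
End Map.

Variable C : chain_complex A.

Lemma res_complex_dd k (x : resmod phi (C k.+2)) :
  res_map (cc_d C k) (res_map (cc_d C k.+1) x) = 0.
Proof. exact: cc_dd. Qed.

Definition res_complex : chain_complex S :=
  @ChainComplex S (fun k => resmod phi (C k))
    (fun k => res_map (cc_d C k)) res_complex_dd.

End RestrictComplex.

Section Subgroup.
Variables (G : groupType) (L : groupClosed G).

Definition subgroup : Type := {x : G | x \in L}.

HB.instance Definition _ := SubChoice.on subgroup.

Lemma subgroup_closed : group_closed (fun x => x \in L).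
Proof. by split; [exact: gpred1|move=> x y; exact: gpredF]. Qed.

HB.instance Definition _ :=
  SubChoice_isSubGroup.Build G (fun x => x \in L) subgroup subgroup_closed.

Definition subgroup_incl (Z : pzRingType) :
    equivariant_pair (trivial_action Z subgroup) (trivial_action Z G) :=
  @EquivariantPair _ _ _ _ (trivial_action Z subgroup) (trivial_action Z G)
    (idfun : {rmorphism Z -> Z}) (val : subgroup -> G) erefl
    (fun _ _ => erefl) (fun _ _ => erefl).

Definition group_ring_incl (Z : pzRingType) :
    {rmorphism group_ring Z subgroup -> group_ring Z G} :=
  crossed_map (subgroup_incl Z).

End Subgroup.

Definition left_coset (G : groupType) (g : G) (L : groupClosed G) : set G :=
  [set (g * x)%g | x in [set x | x \in L]].

Record residual_chain (G : groupType) := ResidualChain {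
  rc_group :> nat -> groupClosed G;
  rc_normal : forall i g x, x \in rc_group i -> (g * x * g^-1)%g \in rc_group i;
  rc_finite_index : forall i, finite_set [set left_coset g (rc_group i) | g in setT];
  rc_descending : forall i x, x \in rc_group i.+1 -> x \in rc_group i;
  rc_trivial : forall x, (forall i, x \in rc_group i) -> x = 1%g }.

Section Norms.
Variable R : realType.
Local Open Scope ereal_scope.

(** Operator norm of [f] with respect to the norms [nU] and [nV]; it is [+oo]
    if [f] is unbounded. *)
Definition opnorm (U V : Type) (nU : U -> \bar R) (nV : V -> \bar R) (f : U -> V)
  : \bar R :=
  ereal_inf [set c%:E | c in
    [set c : R | (0 <= c)%R /\ forall z, nV (f z) <= c%:E * nU z]].

(** The [l^1]-norm for the [Z]-basis [G * I] of the free [ZG]-module on [I]. *)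
Definition l1norm (G : groupType) (I : choiceType)
    (x : freemod (group_ring int G) I) : \bar R :=
  (\sum_(i \in [set: I]) \sum_(g \in [set: G])
     (`|(x i : freemod int G) g|%:~R : R))%R%:E.

End Norms.

Definition finitely_generated (A : pzRingType) (M : lmodType A) : Prop :=
  exists n (s : 'I_n -> M), forall m, exists c : 'I_n -> A, m = \sum_i c i *: s i.

Definition has_rank (A : pzRingType) (M : lmodType A) (n : nat) : Prop :=
  exists f : {linear M -> freemod A 'I_n}, bijective f.

(** The restriction of a based free [ZG]-module to [ZL] is based by translating
    the basis along coset representatives; the associated [Z]-basis is the one
    of the [ZG]-module, so that [l1norm] over [G] is the norm on [res_complex]. *)
Definition CERP (R : realType) (G : groupType) (m : nat) : Prop :=
  exists (C : free_resolution int G) (kappa : R),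
  [/\ 1 <= kappa,
      forall j, (j <= m)%N -> finitely_generated (C j) &
      forall (T : R) (L : residual_chain G), 1 <= T ->
      exists i0 : nat, forall i, (i0 <= i)%N ->
      let incl := group_ring_incl (L i) int in
      let ResC := res_complex incl C in
      let bound := (expR kappa * T `^ kappa)%:E in
      exists (E : based_complex (group_ring int (subgroup (L i))))
        (f : forall k, {linear ResC k -> E k}) (g : forall k, {linear E k -> ResC k})
        (H : forall k, {linear ResC k -> ResC k.+1}),
      [/\ is_homotopy_retract f g H,
          forall j, (j <= m)%N -> exists p q : nat,
            [/\ has_rank (E j) p, has_rank (ResC j) q & p%:R <= kappa / T * q%:R],
          forall j, (j < m)%N ->
            (opnorm (@l1norm R _ _) (@l1norm R _ _) (cc_d E j) <= bound)%E &
          forall j, (j <= m)%N ->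
            [/\ (opnorm (@l1norm R _ (bc_basis C j)) (@l1norm R _ _) (f j) <= bound)%E,
                (opnorm (@l1norm R _ _) (@l1norm R _ (bc_basis C j)) (g j) <= bound)%E &
                (opnorm (@l1norm R _ (bc_basis C j)) (@l1norm R _ (bc_basis C j.+1))
                   (H j) <= bound)%E]]].

(** Countability makes sums and products of functions measurable for the discrete
    sigma-algebra of [Z]. *)
Record normed_ring (R : realType) (Z : comPzRingType) := NormedRing {
  nr_norm :> Z -> R;
  nr_countable : countable [set: Z];
  nr_ge0 : forall a, 0 <= nr_norm a;
  nr_eq0 : forall a, nr_norm a = 0 <-> a = 0;
  nrN : forall a, nr_norm (- a) = nr_norm a;
  nrD : forall a b, nr_norm (a + b) <= nr_norm a + nr_norm b;
  nrM : forall a b, nr_norm (a * b) <= nr_norm a * nr_norm b }.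

Section IntNorm.
Variable R : realType.

Definition int_abs (z : int) : R := `|z|%:~R.

Lemma int_abs_eq0 a : int_abs a = 0 <-> a = 0.
Proof.
split=> [/eqP|->]; last by rewrite /int_abs normr0.
by rewrite intr_eq0 normr_eq0 => /eqP.
Qed.

Lemma int_absN a : int_abs (- a) = int_abs a.
Proof. by rewrite /int_abs normrN. Qed.

Lemma int_absD a b : int_abs (a + b) <= int_abs a + int_abs b.
Proof. by rewrite /int_abs -rmorphD /= ler_int ler_normD. Qed.

Lemma int_absM a b : int_abs (a * b) <= int_abs a * int_abs b.
Proof. by rewrite /int_abs -rmorphM /= normrM. Qed.

Definition int_norm : normed_ring R int :=
  @NormedRing R int int_abs (countableP _) (fun a => ltac:(by rewrite ler0z))
    int_abs_eq0 int_absN int_absD int_absM.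
End IntNorm.

Section FiniteFieldNorm.
Variables (R : realType) (F : finFieldType).

Definition trivial_abs (x : F) : R := (x != 0)%:R.

Lemma trivial_abs_ge0 a : 0 <= trivial_abs a.
Proof. exact: ler0n. Qed.

Lemma trivial_abs_eq0 a : trivial_abs a = 0 <-> a = 0.
Proof.
rewrite /trivial_abs; split=> [/eqP|->]; last by rewrite eqxx.
by rewrite pnatr_eq0 eqb0 negbK => /eqP.
Qed.

Lemma trivial_absN a : trivial_abs (- a) = trivial_abs a.
Proof. by rewrite /trivial_abs oppr_eq0. Qed.

Lemma trivial_absD a b : trivial_abs (a + b) <= trivial_abs a + trivial_abs b.
Proof.
rewrite /trivial_abs -natrD ler_nat.
by have [->|] := eqVneq a 0; [rewrite add0r|case: (_ != 0); case: (_ != 0)].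
Qed.

Lemma trivial_absM a b : trivial_abs (a * b) <= trivial_abs a * trivial_abs b.
Proof. by rewrite /trivial_abs mulf_eq0 negb_or -natrM mulnb. Qed.

Definition trivial_norm : normed_ring R F :=
  @NormedRing R F trivial_abs (countableP _) trivial_abs_ge0
    trivial_abs_eq0 trivial_absN trivial_absD trivial_absM.
End FiniteFieldNorm.

Section BoundedFunctions.
Variables (d : measure_display) (X : measurableType d) (R : realType).
Variables (mu : probability X R) (Z : comPzRingType) (N : normed_ring R Z).

Definition ess_bounded_measurable (f : X -> Z) : bool :=
  `[< (forall B : set Z, measurable (f @^-1` B)) /\
      exists M : R, {ae mu, forall x, N (f x) <= M} >].

Lemma measurable_op (op : Z -> Z -> Z) (f g : X -> Z) :
  (forall B : set Z, measurable (f @^-1` B)) ->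
  (forall B : set Z, measurable (g @^-1` B)) ->
  forall B : set Z, measurable ((fun x => op (f x) (g x)) @^-1` B).
Proof.
move=> mf mg B.
rewrite (_ : _ @^-1` _ = \bigcup_(z in [set: Z])
    (f @^-1` [set z] `&` g @^-1` [set t | B (op z t)])).
  by apply: countable_bigcupT_measurable; [exact: nr_countable N|
    move=> z; apply: measurableI].
by apply/seteqP; split=> [x Bx|x [z _ [/= -> ]]] //; exists (f x).
Qed.

Lemma ess_bounded_measurable_subring : subring_closed ess_bounded_measurable.
Proof.
split=> [|f g|f g].
- apply/asboolP; split=> [B|]; last by exists (N 1); exact: aeW.
  rewrite (_ : _ @^-1` _ = if 1 \in B then setT else set0).
    by case: ifP.
  by apply/seteqP; split=> x /=; case: ifPn; rewrite ?inE // notin_setE.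
- move=> /asboolP[mf [M fM]] /asboolP[mg [K gK]]; apply/asboolP; split.
    exact: (@measurable_op (fun a b => a - b)).
  exists (M + K); apply: filterS2 fM gK => x fM gK.
  by rewrite (le_trans (nrD _ _ _)) // nrN lerD.
- move=> /asboolP[mf [M fM]] /asboolP[mg [K gK]]; apply/asboolP; split.
    exact: (@measurable_op (fun a b => a * b)).
  exists (M * K); apply: filterS2 fM gK => x fM gK.
  by rewrite (le_trans (nrM _ _ _)) // ler_pM // nr_ge0.
Qed.

HB.instance Definition _ :=
  GRing.isSubringClosed.Build (X -> Z) ess_bounded_measurable
    ess_bounded_measurable_subring.

Record bmfun := BMFun {
  bm_fun :> X -> Z;
  bm_funP : ess_bounded_measurable bm_fun }.

HB.instance Definition _ := [isSub for bm_fun].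
HB.instance Definition _ := [Choice of bmfun by <:].
HB.instance Definition _ :=
  GRing.SubChoice_isSubComPzRing.Build (X -> Z) ess_bounded_measurable bmfun
    ess_bounded_measurable_subring.

Definition bm_ae_eq (f g : bmfun) : bool := `[< {ae mu, forall x, f x = g x} >].

Lemma bm_ae_eq_refl : reflexive bm_ae_eq.
Proof. by move=> f; apply/asboolP/aeW. Qed.

Lemma bm_ae_eq_sym : symmetric bm_ae_eq.
Proof.
by move=> f g; apply/idP/idP => /asboolP h; apply/asboolP; apply: filterS h.
Qed.

Lemma bm_ae_eq_trans : transitive bm_ae_eq.
Proof.
move=> f g h /asboolP gf /asboolP fh; apply/asboolP.
by apply: filterS2 gf fh => x -> ->.
Qed.

Canonical bm_ae_eq_equiv :=
  EquivRel bm_ae_eq bm_ae_eq_refl bm_ae_eq_sym bm_ae_eq_trans.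

Local Open Scope quotient_scope.

Definition Linfty : Type := {eq_quot bm_ae_eq}%qT.
HB.instance Definition _ := Choice.on Linfty.
HB.instance Definition _ := EqQuotient.on Linfty.

Definition Lcls (f : bmfun) : Linfty := \pi_Linfty f.

Lemma LclsP f g : Lcls f = Lcls g <-> {ae mu, forall x, f x = g x}.
Proof.
rewrite /Lcls; split=> [|fg]; first by move=> /eqmodP/asboolP.
by apply/eqmodP/asboolP.
Qed.

Lemma Lcls_repr (x : Linfty) : Lcls (repr x) = x.
Proof. exact: reprK. Qed.

Lemma repr_Lcls (f : bmfun) : {ae mu, forall x, repr (Lcls f) x = f x}.
Proof. by apply/LclsP; rewrite Lcls_repr. Qed.

Lemma Linfty_ind (P : Linfty -> Prop) : (forall f, P (Lcls f)) -> forall x, P x.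
Proof. by move=> PL x; rewrite -[x]Lcls_repr. Qed.

Definition Ladd (x y : Linfty) : Linfty := Lcls (repr x + repr y).
Definition Lopp (x : Linfty) : Linfty := Lcls (- repr x).
Definition Lmul (x y : Linfty) : Linfty := Lcls (repr x * repr y).

Lemma LaddE f g : Ladd (Lcls f) (Lcls g) = Lcls (f + g).
Proof.
apply/LclsP; apply: filterS2 (repr_Lcls f) (repr_Lcls g) => x fx gx.
by change (repr (Lcls f) x + repr (Lcls g) x = f x + g x); rewrite fx gx.
Qed.

Lemma LoppE f : Lopp (Lcls f) = Lcls (- f).
Proof.
apply/LclsP; apply: filterS (repr_Lcls f) => x fx.
by change (- repr (Lcls f) x = - f x); rewrite fx.
Qed.

Lemma LmulE f g : Lmul (Lcls f) (Lcls g) = Lcls (f * g).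
Proof.
apply/LclsP; apply: filterS2 (repr_Lcls f) (repr_Lcls g) => x fx gx.
by change (repr (Lcls f) x * repr (Lcls g) x = f x * g x); rewrite fx gx.
Qed.

Lemma LaddA : associative Ladd.
Proof.
by elim/Linfty_ind=> f; elim/Linfty_ind=> g; elim/Linfty_ind=> h;
  rewrite !LaddE addrA.
Qed.

Lemma LaddC : commutative Ladd.
Proof. by elim/Linfty_ind=> f; elim/Linfty_ind=> g; rewrite !LaddE addrC. Qed.

Lemma Ladd0 : left_id (Lcls 0) Ladd.
Proof. by elim/Linfty_ind=> f; rewrite LaddE add0r. Qed.

Lemma LaddN : left_inverse (Lcls 0) Lopp Ladd.
Proof. by elim/Linfty_ind=> f; rewrite LoppE LaddE addNr. Qed.

HB.instance Definition _ :=
  GRing.isZmodule.Build Linfty LaddA LaddC Ladd0 LaddN.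

Lemma LmulA : associative Lmul.
Proof.
by elim/Linfty_ind=> f; elim/Linfty_ind=> g; elim/Linfty_ind=> h;
  rewrite !LmulE mulrA.
Qed.

Lemma LmulC : commutative Lmul.
Proof. by elim/Linfty_ind=> f; elim/Linfty_ind=> g; rewrite !LmulE mulrC. Qed.

Lemma Lmul1 : left_id (Lcls 1) Lmul.
Proof. by elim/Linfty_ind=> f; rewrite LmulE mul1r. Qed.

Lemma LmulDl : left_distributive Lmul Ladd.
Proof.
by elim/Linfty_ind=> f; elim/Linfty_ind=> g; elim/Linfty_ind=> h;
  rewrite !(LaddE, LmulE) mulrDl.
Qed.

HB.instance Definition _ :=
  GRing.Zmodule_isComPzRing.Build Linfty LmulA LmulC Lmul1 LmulDl.

Lemma LclsD f g : Lcls (f + g) = Lcls f + Lcls g.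
Proof. by rewrite -LaddE. Qed.

Lemma LclsM f g : Lcls (f * g) = Lcls f * Lcls g.
Proof. by rewrite -LmulE. Qed.

Lemma LclsB f g : Lcls (f - g) = Lcls f - Lcls g.
Proof. by rewrite LclsD -LoppE. Qed.

Lemma const_bm (z : Z) : ess_bounded_measurable (cst z).
Proof.
apply/asboolP; split=> [B|]; last by exists (N z); exact: aeW.
rewrite (_ : _ @^-1` _ = if z \in B then setT else set0).
  by case: ifP.
by apply/seteqP; split=> x /=; case: ifPn; rewrite ?inE // notin_setE.
Qed.

Definition Lconst (z : Z) : Linfty := Lcls (BMFun (const_bm z)).

Lemma Lconst_zmod : zmod_morphism Lconst.
Proof. by move=> a b; rewrite -LclsB; congr Lcls; apply/val_inj. Qed.

Lemma Lconst_monoid : monoid_morphism Lconst.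
Proof.
by split=> [|a b]; [|rewrite -LclsM]; congr Lcls; apply/val_inj.
Qed.

HB.instance Definition _ := GRing.isZmodMorphism.Build Z Linfty Lconst Lconst_zmod.
HB.instance Definition _ :=
  GRing.isMonoidMorphism.Build Z Linfty Lconst Lconst_monoid.

Lemma indic_bm (A : set X) : measurable A -> ess_bounded_measurable (\1_A : X -> Z).
Proof.
move=> mA; apply/asboolP; split=> [B|].
  rewrite (_ : _ @^-1` _ = (A `&` (if 1 \in B then setT else set0)) `|`
      (~` A `&` (if 0 \in B then setT else set0))).
    by apply: measurableU; apply: measurableI => //; [|exact: measurableC|];
      case: ifP.
  apply/seteqP; split=> x /=; rewrite indicE.
    have [xA Bx|xA Bx] := boolP (x \in A); [left|right].
      by split; [exact/set_mem|rewrite ifT // inE].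
    by split; [move: xA; rewrite notin_setE|rewrite ifT // inE].
  case=> -[xA]; case: ifP => //; rewrite inE => Bx _.
    by rewrite mem_set.
  by rewrite memNset.
exists (N 1 + N 0); apply: aeW => x; rewrite indicE.
by case: (_ \in _); rewrite ?lerDl ?lerDr nr_ge0.
Qed.

Definition Lindic (A : set X) (mA : measurable A) : Linfty :=
  Lcls (BMFun (indic_bm mA)).

End BoundedFunctions.

(** Countability of [G] and standardness of [X] play no role in the definitions
    below and are not recorded. *)
Record free_pmp_action (G : groupType) (d : measure_display)
    (X : measurableType d) (R : realType) (mu : probability X R) := FreePmpAction {
  pa_act :> G -> X -> X;
  pa1 : forall x, pa_act 1%g x = x;
  paM : forall g h x, pa_act (g * h)%g x = pa_act g (pa_act h x);
  pa_measurable : forall g, measurable_fun setT (pa_act g);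
  pa_preserving : forall g (A : set X), measurable A ->
    mu (pa_act g @^-1` A) = mu A;
  pa_free : {ae mu, forall x, forall g, pa_act g x = x -> g = 1%g} }.

Section LinftyAction.
Variables (G : groupType) (d : measure_display) (X : measurableType d).
Variables (R : realType) (mu : probability X R) (alpha : free_pmp_action G mu).
Variables (Z : comPzRingType) (N : normed_ring R Z).

Lemma ae_translate g (P : X -> Prop) :
  {ae mu, forall x, P x} -> {ae mu, forall x, P (alpha g x)}.
Proof.
case=> B [mB B0 PB]; exists (alpha g @^-1` B); split.
- by rewrite -[_ @^-1` _]setTI; exact: pa_measurable.
- by rewrite pa_preserving.
- by move=> x /PB.
Qed.

Lemma translate_bm g (f : bmfun mu N) :
  ess_bounded_measurable mu N (fun x => f (alpha g x)).
Proof.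
have /asboolP[mf [M fM]] := bm_funP f; apply/asboolP; split=> [B|].
  by rewrite -[_ @^-1` _]setTI; exact: (pa_measurable alpha g measurableT (mf B)).
by exists M; exact: (ae_translate g fM).
Qed.

Definition bm_translate g (f : bmfun mu N) : bmfun mu N := BMFun (translate_bm g f).

(** [(g . f) x = f (g^-1 x)] *)
Definition Lact g (f : Linfty mu N) : Linfty mu N :=
  Lcls (bm_translate g^-1%g (repr f)).

Lemma LactE g f : Lact g (Lcls f) = Lcls (bm_translate g^-1%g f).
Proof. by apply/LclsP; exact: (ae_translate g^-1%g (repr_Lcls f)). Qed.

Lemma Lact_zmod g : zmod_morphism (Lact g).
Proof.
elim/Linfty_ind=> f; elim/Linfty_ind=> h; rewrite -LclsB !LactE -LclsB.
by congr Lcls; apply/val_inj.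
Qed.

Lemma Lact_monoid g : monoid_morphism (Lact g).
Proof.
split; first by rewrite [LHS]LactE; congr Lcls; apply/val_inj.
elim/Linfty_ind=> f; elim/Linfty_ind=> h; rewrite -LclsM !LactE -LclsM.
by congr Lcls; apply/val_inj.
Qed.

HB.instance Definition _ g :=
  GRing.isZmodMorphism.Build (Linfty mu N) (Linfty mu N) (Lact g) (Lact_zmod g).
HB.instance Definition _ g :=
  GRing.isMonoidMorphism.Build (Linfty mu N) (Linfty mu N) (Lact g) (Lact_monoid g).

Lemma Lact1 f : Lact 1%g f = f.
Proof.
elim/Linfty_ind: f => f; rewrite LactE; congr Lcls; apply/val_inj/funext => x /=.
by rewrite invg1 pa1.
Qed.

Lemma LactM g h f : Lact (g * h)%g f = Lact g (Lact h f).
Proof.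
elim/Linfty_ind: f => f; rewrite !LactE; congr Lcls.
by apply/val_inj/funext => x /=; rewrite invgM paM.
Qed.

Definition Linfty_action : ring_action G (Linfty mu N) :=
  @RingAction G (Linfty mu N) (fun g => Lact g : {rmorphism _ -> _}) Lact1 LactM.

Definition crossed_ring : pzRingType := crossed Linfty_action.

Lemma Lconst_equiv g z : Lconst mu N z = Linfty_action g (Lconst mu N z).
Proof. by rewrite [RHS]LactE; congr Lcls; apply/val_inj. Qed.

Definition const_incl : equivariant_pair (trivial_action Z G) Linfty_action :=
  @EquivariantPair _ _ _ _ (trivial_action Z G) Linfty_action
    (Lconst mu N : {rmorphism _ -> _}) id erefl (fun _ _ => erefl) Lconst_equiv.

Definition group_ring_to_crossed : {rmorphism group_ring Z G -> crossed_ring} :=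
  crossed_map const_incl.

Record marked := Marked {
  mk_idx : finType;
  mk_set : mk_idx -> set X;
  mk_measurable : forall i, measurable (mk_set i) }.

Definition chi (A : set X) (mA : measurable A) : crossed_ring :=
  delta 1%g (Lindic mu N mA).

(** The left ideal [<A>] generated by the characteristic function of [A]. *)
Definition in_ideal (A : set X) (mA : measurable A) (x : crossed_ring) : Prop :=
  exists a : crossed_ring, x = a * chi mA.

Definition in_marked (M : marked) (x : mk_idx M -> crossed_ring^o) : bool :=
  `[< forall i, in_ideal (mk_measurable i) (x i) >].
Arguments in_marked : clear implicits.

Lemma in_marked_submod M : submod_closed (in_marked M).
Proof.
split=> [|a x y /asboolP xM /asboolP yM]; apply/asboolP => i.
  by exists 0; rewrite mul0r.
have [[b xb] [c yc]] := (xM i, yM i).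
exists (a * b + c); rewrite mulrDl -mulrA -xb -yc.
by [].
Qed.

HB.instance Definition _ M :=
  GRing.isSubmodClosed.Build crossed_ring (mk_idx M -> crossed_ring^o) (in_marked M)
    (in_marked_submod M).

(** The module underlying [M], the direct sum of the ideals [<mk_set M i>]. *)
Record marked_mod (M : marked) := MarkedMod {
  mm_val :> mk_idx M -> crossed_ring^o;
  mm_valP : in_marked M mm_val }.

HB.instance Definition _ M := [isSub for @mm_val M].
HB.instance Definition _ M := [Choice of marked_mod M by <:].
HB.instance Definition _ M := [SubChoice_isSubLmodule of marked_mod M by <:].

Record marked_summand (M : marked) := MarkedSummand {
  ms_set : mk_idx M -> set X;
  ms_measurable : forall i, measurable (ms_set i);
  ms_sub : forall i, ms_set i `<=` mk_set i }.

Definition summand_marked M (S : marked_summand M) : marked :=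
  Marked (@ms_measurable M S).
Coercion summand_marked : marked_summand >-> marked.

Definition in_summand M (S : marked_summand M) (x : marked_mod M) : Prop :=
  forall i, in_ideal (@ms_measurable M S i) (x i).

Section SummandInclusion.
Variables (M : marked) (S : marked_summand M).

Lemma chi_sub i : chi (@ms_measurable M S i) * chi (@mk_measurable M i)
  = chi (@ms_measurable M S i).
Proof.
rewrite [LHS]cp_mul_delta mulg1; congr (delta _ _).
rewrite [X in _ * X]Lact1 -LclsM; congr Lcls; apply/val_inj/funext => x /=.
change (\1_(ms_set S i) x * \1_(mk_set i) x = \1_(ms_set S i) x :> Z).
rewrite !indicE -natrM mulnb; case: (boolP (x \in ms_set S i)) => //= xS.
by rewrite mem_set //; apply: ms_sub; exact: set_mem xS.
Qed.

Lemma summand_in_marked (x : marked_mod S) : in_marked M x.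
Proof.
have /asboolP xS := mm_valP x; apply/asboolP => i; have [a xa] := xS i.
by exists (a * chi (@ms_measurable M S i)); rewrite -mulrA chi_sub.
Qed.

Definition summand_incl (x : marked_mod S) : marked_mod M :=
  MarkedMod (summand_in_marked x).

Lemma summand_incl_linear : linear summand_incl.
Proof. by move=> a x y; apply/val_inj. Qed.

HB.instance Definition _ :=
  GRing.isLinear.Build crossed_ring (marked_mod S) (marked_mod M) *:%R
    summand_incl summand_incl_linear.
End SummandInclusion.

Local Open Scope ereal_scope.

Definition mdim (M : marked) : \bar R := \sum_(i : mk_idx M) mu (mk_set i).

Definition crossed_norm (x : crossed_ring) : \bar R :=
  \sum_(g \in [set: G])
     \int[mu]_t (N (repr ((x : crossed Linfty_action) g : Linfty mu N) t))%:E.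

Definition marked_norm (M : marked) (x : marked_mod M) : \bar R :=
  \sum_(i : mk_idx M) crossed_norm (x i).

Definition log_plus (t : \bar R) : \bar R := maxe (lne t) 0.

Section LogNorm.
Variables (M M' : marked) (f : {linear marked_mod M -> marked_mod M'}).

Definition marked_opnorm : \bar R := opnorm (@marked_norm M) (@marked_norm M') f.

Definition marked_rk : \bar R :=
  ereal_inf [set mdim S | S in
    [set S : marked_summand M' | forall x, in_summand S (f x)]].

Definition lognorm' : \bar R :=
  mine (mdim M * log_plus marked_opnorm) (marked_rk * log_plus marked_opnorm).
End LogNorm.

Record marked_decomposition (M : marked) := MarkedDecomposition {
  md_idx : finType;
  md_part :> md_idx -> marked_summand M;
  md_cover : forall i, \bigcup_(k in [set: md_idx]) ms_set (md_part k) i = mk_set i;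
  md_disjoint : forall i, trivIset [set: md_idx] (fun k => ms_set (md_part k) i) }.

Definition lognorm (M M' : marked) (f : {linear marked_mod M -> marked_mod M'})
  : \bar R :=
  ereal_inf [set v | exists D : marked_decomposition M,
    v = \sum_(k : md_idx D)
      lognorm' (f \o summand_incl (S := D k) : {linear marked_mod (D k) -> marked_mod M'})].

Record augmented_complex := AugmentedComplex {
  ac_mod :> nat -> marked;
  ac_d : forall k, {linear marked_mod (ac_mod k.+1) -> marked_mod (ac_mod k)};
  ac_dd : forall k x, ac_d k (ac_d k.+1 x) = 0%R;
  ac_aug : {linear marked_mod (ac_mod 0%N) -> coefmod Linfty_action};
  ac_aug_surj : forall y, exists x, ac_aug x = y;
  ac_aug_d : forall x, ac_aug (ac_d 0%N x) = 0%R }.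

(** Degrees above [r + 1] of [f] are unconstrained: a family defined up to degree
    [r + 1] may be extended by zero. *)
Definition embeds (C : free_resolution Z G) (r : nat) (D : augmented_complex) : Prop :=
  exists f : forall k,
    {linear C k -> resmod group_ring_to_crossed (marked_mod (D k))},
  (forall x, ac_aug D (f 0%N x) = Lconst mu N (fr_aug C x)) /\
  (forall k, (k <= r)%N -> forall x : C k.+1, ac_d D k (f k.+1 x) = f k (cc_d C k x)).

Variable C : free_resolution Z G.

(** Measured embedding dimension in degrees [r <= n], and in the boundary degree
    [n + 1] (for [r > n]). *)
Definition medim (n r : nat) : \bar R :=
  if (r <= n)%N then ereal_inf [set v | exists2 D, embeds C r D & v = mdim (D r)]
  else ereal_inf [set v | exists2 D, embeds C n D & v = mdim (D n.+1)].

Definition mevol (r : nat) : \bar R :=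
  ereal_inf [set v | exists2 D, embeds C r D & v = lognorm (ac_d D r)].

End LinftyAction.

Section ProfiniteCompletion.
Variables (G : groupType) (L : residual_chain G).

(** A point of the inverse limit of the groups [G / L i]: a family of cosets
    with [x i] the image of [x i.+1] under [G / L i.+1 -> G / L i]. *)
Definition is_thread (x : nat -> set G) : bool :=
  `[< forall i, exists g, x i = left_coset g (L i) /\ x i.+1 = left_coset g (L i.+1) >].

Record profinite := Profinite {
  pf_coset :> nat -> set G;
  pf_thread : is_thread pf_coset }.

HB.instance Definition _ := [isSub for pf_coset].
HB.instance Definition _ := [Choice of profinite by <:].

Lemma pfP (x y : profinite) : (forall i, x i = y i) -> x = y.
Proof. by move=> xy; apply/val_inj/funext. Qed.

Lemma left_cosetM g h i :
  [set (a * b)%g | a in left_coset g (L i) & b in left_coset h (L i)] =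
  left_coset (g * h)%g (L i).
Proof.
apply/seteqP; split=> [_ [_ [x /= xL <-] [_ [y /= yL <-] <-]]|_ [x /= xL <-]].
  exists (h^-1 * x * h * y)%g => /=.
    by rewrite gpredM //; have := rc_normal h^-1%g xL; rewrite invgK.
  by rewrite !mulgA mulgK.
exists g; first by exists 1%g => /=; [exact: gpred1|rewrite mulg1].
by exists (h * x)%g; [exists x|rewrite mulgA].
Qed.

Definition pf_mul_fun (x y : profinite) (i : nat) : set G :=
  [set (a * b)%g | a in x i & b in y i].

Lemma pf_mul_thread x y : is_thread (pf_mul_fun x y).
Proof.
apply/asboolP => i; have /asboolP/(_ i)[g [gx gx']] := pf_thread x.
have /asboolP/(_ i)[h [hy hy']] := pf_thread y.
by exists (g * h)%g; rewrite /pf_mul_fun gx gx' hy hy' !left_cosetM.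
Qed.

Definition pf_mul (x y : profinite) : profinite := Profinite (pf_mul_thread x y).

Lemma diag_thread g : is_thread (fun i => left_coset g (L i)).
Proof. by apply/asboolP => i; exists g. Qed.

Definition pf_diag (g : G) : profinite := Profinite (diag_thread g).

Lemma pf_diagE g i : pf_diag g i = left_coset g (L i).
Proof. by []. Qed.

HB.instance Definition _ := isPointed.Build profinite (pf_diag 1%g).

Lemma pf_mul_cosetE (x y : profinite) i g h : x i = left_coset g (L i) -> y i = left_coset h (L i) ->
  pf_mul x y i = left_coset (g * h)%g (L i).
Proof. by move=> xi yi; rewrite -left_cosetM -xi -yi. Qed.

Lemma pf_repr (x : profinite) i : exists g, x i = left_coset g (L i).
Proof. by have /asboolP/(_ i)[g []] := pf_thread x; exists g. Qed.

Lemma pf_mulA x y z : pf_mul x (pf_mul y z) = pf_mul (pf_mul x y) z.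
Proof.
apply: pfP => i; have [[g xi] [h yi]] := (pf_repr x i, pf_repr y i).
have [k zi] := pf_repr z i.
rewrite (pf_mul_cosetE xi (pf_mul_cosetE yi zi)).
by rewrite (pf_mul_cosetE (pf_mul_cosetE xi yi) zi) mulgA.
Qed.

Lemma pf_diagM g h : pf_diag (g * h)%g = pf_mul (pf_diag g) (pf_diag h).
Proof. by apply: pfP => i; rewrite (pf_mul_cosetE (pf_diagE g i) (pf_diagE h i)). Qed.

Lemma pf_mul1 x : pf_mul (pf_diag 1%g) x = x.
Proof.
by apply: pfP => i; have [g xi] := pf_repr x i;
  rewrite (pf_mul_cosetE (pf_diagE _ i) xi) mul1g.
Qed.

(** The inverse limit topology of the finite discrete groups [G / L i]; the
    cylinders at a single level form a basis, the levels being nested. *)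
Definition pf_open (U : set profinite) : Prop :=
  forall x, U x -> exists i, forall y : profinite, y i = x i -> U y.

Definition pf_borel : measurableType _ := g_sigma_algebraType pf_open.

(** The probability measures invariant under left translation by the whole limit
    group; there is exactly one. *)
Definition is_haar (R : realType) (mu : probability pf_borel R) : Prop :=
  forall (x : profinite) (A : set pf_borel), measurable A ->
    mu ((pf_mul x : pf_borel -> pf_borel) @^-1` A) = mu A.

Definition pf_act (g : G) (x : pf_borel) : pf_borel := pf_mul (pf_diag g) x.

Lemma pf_act1 x : pf_act 1%g x = x.
Proof. exact: pf_mul1. Qed.

Lemma pf_actM g h x : pf_act (g * h)%g x = pf_act g (pf_act h x).
Proof. by rewrite /pf_act pf_diagM pf_mulA. Qed.

Lemma pf_act_measurable g : measurable_fun setT (pf_act g).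
Proof.
apply: (@measurability _ _ pf_borel pf_borel setT (pf_act g) pf_open erefl).
move=> _ [U oU <-]; apply: sub_sigma_algebra => x [_ Ux].
have [i iU] := oU _ Ux; exists i => y yx; split=> //; apply: iU.
by rewrite /pf_act /= /pf_mul_fun yx.
Qed.

Lemma pf_act_free g (x : pf_borel) : pf_act g x = x -> g = 1%g.
Proof.
move=> gx; apply: (@rc_trivial G L) => i.
have [h xi] := pf_repr x i.
have : left_coset (g * h)%g (L i) = left_coset h (L i).
  by rewrite -(pf_mul_cosetE (pf_diagE g i) xi) -xi; congr (pf_coset _ i).
move/seteqP => [+ _] => /(_ (g * h)%g) []; first by exists 1%g; [exact: gpred1|rewrite mulg1].
move=> l /= lL hl; have -> : g = (h * l * h^-1)%g by rewrite hl mulgK.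
exact: rc_normal.
Qed.

Variables (R : realType) (mu : probability pf_borel R) (haar : is_haar mu).

Definition profinite_completion : free_pmp_action G mu :=
  @FreePmpAction G _ pf_borel R mu pf_act pf_act1 pf_actM pf_act_measurable
    (fun g => haar (pf_diag g)) (aeW mu (fun x g => @pf_act_free g x)).

End ProfiniteCompletion.

(* Main.v *)
Require Import Defs.
From HB Require Import structures.
From mathcomp Require Import all_boot all_order all_algebra finmap.
From mathcomp Require Import all_classical all_reals all_analysis.
From mathcomp Require Import measurable_realfun ring lra.

(** The rebuilt complexes are induced up to the crossed product ring [CR] of [G] with
    the bounded functions on the profinite completion [X].

    Let [K] be a group of the chain, of finite index, and let [Y] be the closure of
    [K] in [X]: the cylinder of points whose coset at that level is [K]. It is
    invariant under [K], and its translates by coset representatives partition [X],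
    so [mu Y] is the inverse of the index of [K]. By invariance, [chiY] commutes
    with [Z[K]], so a based complex [E] over [Z[K]] induces a complex of marked
    projective modules: one summand [<Y>] for each basis element of [E], with the
    same matrices as differentials ([rmul]).

    If [E] comes from cheap rebuilding with parameter [T], then
    - the dimension in degree [j] is [rk E_j * mu Y]; restricting [C_j] to [K]
      multiplies its number of generators by the index, so this is at most
      [kappa / T] times a number that depends only on [C_j] ([restriction_rank],
      [measure_coset]);
    - the operator norms of the induced differentials are at most those of [E]
      ([opnorm_rmul]), hence at most [exp kappa * T ^ kappa], whose logarithm is
      [kappa * (1 + ln T)].
    Since the logarithmic norm is at most the dimension times the logarithm of the
    operator norm ([lognorm_le]), all three quantities tend to [0] as [T] grows.

    The induced complex has to receive a [Z[G]]-chain map from the given resolution.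
    From the resolution [C] of the rebuilding property such a map is the transfer
    [x |-> \sum_(t K) t chiY (x) f (t^-1 x)], where [f] is the chain map to [E]. It is
    compatible with the augmentations because [g f] is homotopic to the identity
    and the translates of [Y] partition [X] ([transfer_aug]). Another resolution,
    over the integers or over a finite field [Z], maps to [Z (x) C], which is still
    exact because [C] has a contraction by additive maps ([base_change_exact],
    [exists_comparison]). The transfer extends to [Z (x) C], as its target is a
    [Z]-module. *)

Set Implicit Arguments.
Unset Strict Implicit.
Unset Printing Implicit Defensive.

Import Order.TTheory GRing.Theory Num.Theory.

Local Open Scope ring_scope.

(** * Free modules over group rings *)

Section LinearExtension.
Variables (A : pzRingType) (I : choiceType) (W : lmodType A) (phi : I -> W).

Definition linear_ext (x : freemod A I) : W := fm_ext (fun i a => a *: phi i) x.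

Lemma linear_ext_delta i a : linear_ext (delta i a) = a *: phi i.
Proof. by apply: fm_ext_delta => j; rewrite scale0r. Qed.

Lemma delta_scale a i b : a *: (delta i b : freemod A I) = delta i (a * b).
Proof. by apply/fmP => j; rewrite fmZ !deltaE; case: ifP; rewrite ?mulr0. Qed.

Lemma linear_ext_is_linear : linear linear_ext.
Proof.
have extD x y : linear_ext (x + y) = linear_ext x + linear_ext y.
  by apply: fm_extD => [i|i a b]; rewrite ?scale0r ?scalerDl.
have ext0 : linear_ext 0 = 0 by apply: fm_ext0 => i; rewrite scale0r.
move=> a x y; rewrite extD; congr (_ + _); move: x.
apply: fm_ind => [|u v IHu IHv|i b]; first by rewrite scaler0 ext0 scaler0.
- by rewrite scalerDr !extD IHu IHv scalerDr.
- by rewrite delta_scale !linear_ext_delta scalerA.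
Qed.

HB.instance Definition _ :=
  GRing.isLinear.Build A (freemod A I) W *:%R linear_ext linear_ext_is_linear.

End LinearExtension.

Lemma freemod_linear_eq (A : pzRingType) (I : choiceType) (W : lmodType A)
    (u v : {linear freemod A I -> W}) :
  (forall i, u (delta i 1) = v (delta i 1)) -> u =1 v.
Proof.
move=> uv; apply: fm_ind => [|x y ux uy|i a]; first by rewrite !linear0.
  by rewrite !linearD ux uy.
by rewrite -[a]mulr1 -delta_scale !linearZ uv.
Qed.

Lemma fm_sumE (A : pzRingType) (I : choiceType) (T : Type) (r : seq T) (P : pred T)
    (F : T -> freemod A I) i :
  (\sum_(k <- r | P k) F k) i = \sum_(k <- r | P k) F k i :> A.
Proof. by elim/big_rec2: _ => // k y1 y2 _ <-. Qed.

Lemma delta_zmod (A : pzRingType) (I : choiceType) (i : I) :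
  zmod_morphism (delta i : A -> freemod A I).
Proof.
by move=> a b; apply/fmP => j; rewrite fmD fmN !deltaE; case: ifP; rewrite ?subr0.
Qed.

HB.instance Definition _ (A : pzRingType) (I : choiceType) (i : I) :=
  GRing.isZmodMorphism.Build A (freemod A I) (delta i) (@delta_zmod A I i).

Definition monomial (Z : pzRingType) (G : groupType) (g : G) (z : Z) : group_ring Z G :=
  delta g z.

Section GroupRingBasics.
Variables (Z : pzRingType) (G : groupType).

Lemma monomialM (g h : G) (a b : Z) :
  monomial g a * monomial h b = monomial (g * h)%g (a * b).
Proof. exact: cp_mul_delta. Qed.

Lemma monomial_zmod (g : G) : zmod_morphism (monomial g : Z -> group_ring Z G).
Proof. exact: delta_zmod. Qed.

HB.instance Definition _ g :=
  GRing.isZmodMorphism.Build Z (group_ring Z G) (monomial g) (monomial_zmod g).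

Lemma monomial_int (g : G) (z : int) :
  monomial g (z%:~R : Z) = monomial g 1 *~ z :> group_ring Z G.
Proof. exact: (raddfMz (monomial g)). Qed.

Lemma monomialD (g : G) (a b : Z) : monomial g (a + b) = monomial g a + monomial g b.
Proof. exact: deltaD. Qed.

Lemma trivial_mod_monomial (g : G) (a : Z) (z : trivial_mod Z G) :
  monomial g a *: z = (a * z : Z).
Proof. exact: cp_scale_delta. Qed.

Lemma group_ring_ind (P : group_ring Z G -> Prop) :
  P 0 -> (forall x y, P x -> P y -> P (x + y)) ->
  (forall g z, P (monomial g z)) -> forall x, P x.
Proof. exact: fm_ind. Qed.

(** Induction along the underlying [Z]-basis [G * I], for properties that are
    additive but not compatible with multiplication by group elements. *)
Lemma group_freemod_ind (I : choiceType) (P : freemod (group_ring Z G) I -> Prop) :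
  P 0 -> (forall x y, P x -> P y -> P (x + y)) ->
  (forall i g z, P (delta i (monomial g z))) -> forall x, P x.
Proof.
move=> P0 PD Pd; apply: fm_ind => // i; apply: group_ring_ind => [|x y Px Py|g z //].
  by rewrite delta0.
by rewrite deltaD; apply: PD.
Qed.

End GroupRingBasics.

Lemma delta_monomial_int (G : groupType) (I : choiceType) i g (z : int) :
  delta i (monomial g z) = delta i (monomial g 1) *~ z :> freemod (group_ring int G) I.
Proof. by rewrite -{1}[z]intz monomial_int; exact: (raddfMz (delta i)). Qed.

(** * Changing the coefficients of a free resolution *)

Section BiadditiveExtension.
Variables (Z : pzRingType) (G : groupType) (I : choiceType) (V : zmodType).
Variable phi : I -> G -> Z -> V.
Hypothesis phiD : forall i g a b, phi i g (a + b) = phi i g a + phi i g b.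

Definition group_ext (x : freemod (group_ring Z G) I) : V :=
  fm_ext (fun i (a : group_ring Z G) => fm_ext (phi i) a) x.

Let phi0 i g : phi i g 0 = 0.
Proof. by apply: (addIr (phi i g 0)); rewrite -phiD !add0r. Qed.

Lemma group_extD x y : group_ext (x + y) = group_ext x + group_ext y.
Proof.
apply: fm_extD => [i|i a b]; first by apply: fm_ext0 => g.
by apply: fm_extD.
Qed.

Lemma group_ext_zmod : zmod_morphism group_ext.
Proof.
have e0 : group_ext 0 = 0.
  by apply: (addIr (group_ext 0)); rewrite -group_extD !add0r.
move=> x y; rewrite group_extD; congr (_ + _).
by apply: (addIr (group_ext y)); rewrite -group_extD !addNr.
Qed.

Lemma group_ext_delta i g z : group_ext (delta i (monomial g z)) = phi i g z.
Proof.
rewrite /group_ext fm_ext_delta => [|j]; last by apply: fm_ext0.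
by rewrite fm_ext_delta.
Qed.

(** Additive but not necessarily equivariant maps, such as contracting homotopies,
    are prescribed on the [Z]-basis [G * I] of the module. *)
Lemma exists_group_ext : exists s : {additive freemod (group_ring Z G) I -> V},
  forall i g z, s (delta i (monomial g z)) = phi i g z.
Proof.
pose m := GRing.isZmodMorphism.Build _ _ group_ext group_ext_zmod.
pose s : {additive freemod (group_ring Z G) I -> V} := HB.pack group_ext m.
by exists s => i g z /=; rewrite group_ext_delta.
Qed.

End BiadditiveExtension.

Section CoefficientMap.
Variables (Z : pzRingType) (G : groupType) (I : choiceType).

Definition coef_change : freemod (group_ring int G) I -> freemod (group_ring Z G) I :=
  group_ext (fun i g (z : int) => delta i (monomial g (z%:~R : Z))).

Let phiD i g (a b : int) :
  delta i (monomial g ((a + b)%:~R : Z)) =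
  delta i (monomial g a%:~R) + delta i (monomial g b%:~R) :> freemod (group_ring Z G) I.
Proof. by rewrite intrD monomialD deltaD. Qed.

HB.instance Definition _ := GRing.isZmodMorphism.Build _ _ coef_change (group_ext_zmod phiD).

Lemma coef_change_delta i g z :
  coef_change (delta i (monomial g z)) = delta i (monomial g z%:~R).
Proof. exact: (group_ext_delta phiD). Qed.

Lemma coef_change_basis i : coef_change (delta i 1) = delta i 1.
Proof. exact: coef_change_delta. Qed.

Lemma coef_change0 : coef_change 0 = 0.
Proof. exact: raddf0. Qed.

Lemma coef_changeD x y : coef_change (x + y) = coef_change x + coef_change y.
Proof. exact: raddfD. Qed.

Lemma coef_changeB x y : coef_change (x - y) = coef_change x - coef_change y.
Proof. exact: raddfB. Qed.

Lemma coef_changeMz x z : coef_change (x *~ z) = coef_change x *~ z.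
Proof. exact: raddfMz. Qed.

Lemma coef_change_scale g z x :
  coef_change (monomial g z *: x) = monomial g z%:~R *: coef_change x.
Proof.
elim/group_freemod_ind: x => [|x y IHx IHy|i h w].
- by rewrite !(coef_change0, scaler0).
- by rewrite scalerDr !coef_changeD IHx IHy scalerDr.
by rewrite delta_scale monomialM !coef_change_delta delta_scale monomialM intrM.
Qed.

Lemma delta_coef_change i g z :
  delta i (monomial g z) = monomial 1%g z *: coef_change (delta i (monomial g 1)).
Proof. by rewrite coef_change_delta delta_scale monomialM mul1g mulr1. Qed.

Lemma coef_change_ind (P : freemod (group_ring Z G) I -> Prop) :
  P 0 -> (forall x y, P x -> P y -> P (x + y)) ->
  (forall z x, P (monomial 1%g z *: coef_change x)) -> forall x, P x.
Proof.
by move=> P0 PD Pz; apply: group_freemod_ind => // i g z; rewrite delta_coef_change.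
Qed.

Lemma coef_change_linear_eq (W : lmodType (group_ring Z G))
    (u v : {linear freemod (group_ring Z G) I -> W}) :
  (forall x, u (coef_change x) = v (coef_change x)) -> u =1 v.
Proof. by move=> uv; apply: freemod_linear_eq => i; rewrite -coef_change_basis uv. Qed.

(** The universal property of [Z (x) -]: an equivariant additive map out of the
    integral chains is determined by its values on the basis, and these also
    define a map out of the chains with coefficients in [Z]. *)
Lemma exists_coef_ext (W : lmodType (group_ring Z G))
    (phi : {additive freemod (group_ring int G) I -> W}) :
  (forall g x, phi (monomial g 1 *: x) = monomial g 1 *: phi x) ->
  exists Phi : {linear freemod (group_ring Z G) I -> W},
    forall x, Phi (coef_change x) = phi x.
Proof.
move=> phiG; exists (linear_ext (fun i => phi (delta i 1))) => x.
elim/group_freemod_ind: x => [|x y IHx IHy|i g z]; first by rewrite coef_change0 !raddf0.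
  by rewrite coef_changeD !raddfD /= IHx IHy.
rewrite coef_change_delta /= linear_ext_delta monomial_int (delta_monomial_int i g z) raddfMz /=.
rewrite -[monomial g 1 in RHS]mulr1 -delta_scale phiG.
by rewrite scalerMzl.
Qed.

End CoefficientMap.

Arguments coef_change Z {G I}.

(** An additive map of integral chains which need not be equivariant still extends
    to the chains with coefficients in [Z]: the latter are the scalar extension
    of the former as abelian groups. *)
Lemma exists_scalar_ext (Z : pzRingType) (G : groupType) (I J : choiceType)
    (s : {additive freemod (group_ring int G) I -> freemod (group_ring int G) J}) :
  exists t : {additive freemod (group_ring Z G) I -> freemod (group_ring Z G) J},
    forall z x, t (monomial 1%g z *: coef_change Z x) = monomial 1%g z *: coef_change Z (s x).
Proof.
have [i g a b|t tE] := @exists_group_ext Z G I (freemod (group_ring Z G) J)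
  (fun i g z => monomial 1%g z *: coef_change Z (s (delta i (monomial g 1)))).
  by rewrite monomialD scalerDl.
exists t => z; elim/group_freemod_ind => [|x y IHx IHy|i g w].
- by rewrite coef_change0 [s 0]raddf0 coef_change0 !scaler0 raddf0.
- by rewrite [s (x + y)]raddfD !coef_changeD !scalerDr -IHx -IHy raddfD.
rewrite coef_change_delta delta_scale monomialM mul1g tE.
rewrite (delta_monomial_int i g w) [s (_ *~ _)]raddfMz coef_changeMz.
by rewrite -scalerMzr scalerMzl mulrzr (raddfMz (monomial _)).
Qed.

(** * Exactness after a change of coefficients *)

Section Contraction.
Variables (G : groupType) (C : free_resolution int G).
Notation F k := (freemod (group_ring int G) (bc_basis C k)).
Notation d k := (bc_d C k).

(** A resolution by free abelian groups splits additively. Given a section [s] of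
    [d] on the boundaries, each [y - s (d y)] is a cycle, hence a boundary; lifting
    it for [y] in the [Z]-basis gives the next stage of a contraction. *)
Lemma extend_contraction k (s : {additive F k -> F k.+1}) :
  (forall y, d k (s (d k y)) = d k y) ->
  exists t : {additive F k.+1 -> F k.+2}, forall y, d k.+1 (t y) + s (d k y) = y.
Proof.
move=> sP.
have lift (y : F k.+1) : exists z, d k.+1 z = y - s (d k y).
  have /(@fr_exactS _ _ C)[z ->] : d k (y - s (d k y)) = 0 by rewrite linearB /= sP subrr.
  by exists z.
have [i g a b|t tE] := @exists_group_ext int G (bc_basis C k.+1) (F k.+2)
  (fun i g z => sval (cid (lift (delta i (monomial g 1)))) *~ z).
  exact: mulrzDr.
exists t; elim/group_freemod_ind => [|x y IHx IHy|i g z].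
- by rewrite !raddf0 addr0.
- by rewrite !raddfD /= addrACA IHx IHy.
rewrite tE (delta_monomial_int i g z) !raddfMz /=.
by rewrite (svalP (cid (lift _))) -mulrzDl subrK.
Qed.

Definition int_aug : F 0 -> int := fr_aug C.

Lemma int_aug_zmod : zmod_morphism int_aug.
Proof. exact: (raddfB (fr_aug C)). Qed.

HB.instance Definition _ := GRing.isZmodMorphism.Build (F 0) int int_aug int_aug_zmod.

Lemma exists_contraction0 (c : F 0) : int_aug c = 1 ->
  exists s : {additive F 0 -> F 1}, forall x, d 0 (s x) = x - c *~ int_aug x.
Proof.
move=> c1.
have lift (x : F 0) : exists z, d 0 z = x - c *~ int_aug x.
  have /(@fr_exact0 _ _ C)[z ->] : int_aug (x - c *~ int_aug x) = 0.
    by rewrite raddfB raddfMz /= c1 intz subrr.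
  by exists z.
have [i g a b|s sE] := @exists_group_ext int G (bc_basis C 0) (F 1)
  (fun i g z => sval (cid (lift (delta i (monomial g 1)))) *~ z).
  exact: mulrzDr.
exists s; elim/group_freemod_ind => [|x y IHx IHy|i g z].
- by rewrite !raddf0 addr0.
- by rewrite [int_aug _]raddfD mulrzDr !raddfD /= IHx IHy ?opprD addrACA.
rewrite sE (delta_monomial_int i g z) !raddfMz /=.
by rewrite (svalP (cid (lift _))) mulrzBl [int_aug (_ *~ _)]raddfMz mulrzz mulrzA.
Qed.

(** The contraction is built by induction from the augmentation upwards. Only one
    degree is remembered at a time, so that no coherent sequence has to be
    chosen. *)
Lemma exists_section k :
  exists s : {additive F k -> F k.+1}, forall y, d k (s (d k y)) = d k y.
Proof.
elim: k => [|k [s sP]].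
  have [c c1] := fr_aug_surj C 1.
  have [s sP] := exists_contraction0 c1; exists s => y.
  rewrite sP (_ : int_aug (d 0 y) = 0) ?mulr0z ?subr0 //.
  by apply/fr_exact0; exists y.
have [t tP] := extend_contraction sP; exists t => y.
by rewrite -[RHS]tP bc_dd raddf0 addr0.
Qed.

End Contraction.

Section BaseChange.
Variables (Z : pzRingType) (G : groupType) (C : free_resolution int G).
Notation F k := (freemod (group_ring int G) (bc_basis C k)).
Notation FZ k := (freemod (group_ring Z G) (bc_basis C k)).
Notation d k := (bc_d C k).

Lemma exists_base_change_d k : exists dZ : {linear FZ k.+1 -> FZ k},
  forall x, dZ (coef_change Z x) = coef_change Z (d k x).
Proof.
have dz : zmod_morphism (coef_change Z \o d k) by move=> x y; rewrite /= !raddfB.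
pose m := GRing.isZmodMorphism.Build _ _ _ dz.
pose f : {additive F k.+1 -> FZ k} := HB.pack (coef_change Z \o d k) m.
apply: (exists_coef_ext (phi := f)) => g x /=.
by rewrite linearZ /= coef_change_scale.
Qed.

Definition base_change_d k : {linear FZ k.+1 -> FZ k} :=
  sval (cid (exists_base_change_d k)).

Lemma base_change_dE k x : base_change_d k (coef_change Z x) = coef_change Z (d k x).
Proof. exact: svalP (cid (exists_base_change_d k)) x. Qed.

Lemma exists_base_change_aug : exists e : {linear FZ 0 -> trivial_mod Z G},
  forall x, e (coef_change Z x) = (int_aug x)%:~R :> Z.
Proof.
have ez : zmod_morphism (fun x : F 0 => (int_aug x)%:~R : trivial_mod Z G).
  by move=> x y; rewrite raddfB /= rmorphB.
pose m := GRing.isZmodMorphism.Build _ _ _ ez.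
pose f : {additive F 0 -> trivial_mod Z G} := HB.pack (fun x : F 0 => (int_aug x)%:~R : Z) m.
apply: (exists_coef_ext (phi := f)) => g x /=.
rewrite trivial_mod_monomial mul1r; congr (_ *~ _).
by rewrite /int_aug linearZ /= [LHS]trivial_mod_monomial mul1r.
Qed.

Definition base_change_aug : {linear FZ 0 -> trivial_mod Z G} :=
  sval (cid exists_base_change_aug).

Lemma base_change_augE x : base_change_aug (coef_change Z x) = (int_aug x)%:~R :> Z.
Proof. exact: svalP (cid exists_base_change_aug) x. Qed.

(** The functor [Z (x) -] need not preserve exactness, but it preserves additive
    contractions. *)
Lemma base_change_exact k (x : FZ k.+1) :
  base_change_d k x = 0 -> exists y, x = base_change_d k.+1 y.
Proof.
move=> dx; have [s sP] := exists_section C k; have [t tP] := extend_contraction sP.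
have [sZ sZE] := exists_scalar_ext Z s; have [tZ tZE] := exists_scalar_ext Z t.
suff htp : forall y, base_change_d k.+1 (tZ y) + sZ (base_change_d k y) = y.
  by exists (tZ x); rewrite -[LHS](htp x) dx raddf0 addr0.
elim/coef_change_ind => [|y z IHy IHz|z y]; first by rewrite !raddf0 addr0.
  by rewrite !raddfD /= addrACA IHy IHz.
rewrite tZE !linearZ /= !base_change_dE sZE -scalerDr -coef_changeD.
by rewrite tP.
Qed.

Lemma base_change_exact0 (x : FZ 0) :
  base_change_aug x = 0 -> exists y, x = base_change_d 0 y.
Proof.
move=> ex; have [c c1] := fr_aug_surj C 1; have [s sP] := exists_contraction0 c1.
have [sZ sZE] := exists_scalar_ext Z s.
suff htp : forall y, base_change_d 0 (sZ y) =
    y - monomial 1%g (base_change_aug y : Z) *: coef_change Z c.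
  by exists (sZ x); rewrite htp ex [monomial _ 0]raddf0 scale0r subr0.
elim/coef_change_ind => [|y z IHy IHz|z y].
- by rewrite !raddf0 scale0r oppr0 addr0.
- by rewrite [base_change_aug _]raddfD monomialD scalerDl opprD addrACA -IHy -IHz !raddfD.
have -> : base_change_aug (monomial 1%g z *: coef_change Z y) = z * (int_aug y)%:~R :> Z.
  by rewrite linearZ /= base_change_augE; exact: trivial_mod_monomial.
rewrite sZE [base_change_d 0 _]linearZ /= base_change_dE sP.
rewrite coef_changeB coef_changeMz scalerBr; congr (_ - _).
by rewrite mulrzr (raddfMz (monomial 1%g)) -scalerMzl scalerMzr.
Qed.

Variable D : free_resolution Z G.

(** The fundamental lemma of homological algebra: a chain map from the free
    complex [D] to the exact complex [FZ] is chosen degree by degree. *)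
Lemma exists_comparison :
  exists psi : forall k, {linear freemod (group_ring Z G) (bc_basis D k) -> FZ k},
    (forall x, base_change_aug (psi 0%N x) = fr_aug D x) /\
    (forall k x, base_change_d k (psi k.+1 x) = psi k (bc_d D k x)).
Proof.
pose L k := {linear freemod (group_ring Z G) (bc_basis D k) -> FZ k}.
(* The condition under which [u] can be lifted to the next degree. *)
pose P k (u : L k) := forall x, exists y, u (bc_d D k x) = base_change_d k y.
have aug_onto z : exists y, base_change_aug y = z.
  have [c c1] := fr_aug_surj C 1; exists (monomial 1%g (z : Z) *: coef_change Z c).
  by rewrite linearZ /= base_change_augE [int_aug c]c1 [LHS]trivial_mod_monomial mulr1.
have [psi0 [psi0P psi0E]] : exists u : L 0%N, P 0%N u /\
    forall x, base_change_aug (u x) = fr_aug D x.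
  pose u : L 0%N := linear_ext (fun i => sval (cid (aug_onto (fr_aug D (delta i 1))))).
  have uE x : base_change_aug (u x) = fr_aug D x.
    apply: (@freemod_linear_eq _ _ _ (base_change_aug \o u) (fr_aug D)) => i /=.
    by rewrite linear_ext_delta scale1r (svalP (cid (aug_onto _))).
  exists u; split=> // x; apply: base_change_exact0; rewrite uE.
  by apply/(@fr_exact0 _ _ D); exists x.
have step k (u : L k) : P k u -> exists v : L k.+1, P k.+1 v /\
    forall x, base_change_d k (v x) = u (bc_d D k x).
  move=> uP; pose v : L k.+1 := linear_ext (fun i => sval (cid (uP (delta i 1)))).
  have vE x : base_change_d k (v x) = u (bc_d D k x).
    apply: (@freemod_linear_eq _ _ _ (base_change_d k \o v) (u \o bc_d D k)) => i /=.
    by rewrite linear_ext_delta scale1r -(svalP (cid (uP (delta i 1)))).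
  exists v; split=> // x; apply: base_change_exact; rewrite vE.
  by rewrite bc_dd raddf0.
pose psi := fix F k : {u : L k | P k u} :=
  if k is k'.+1 then
    let w := cid (step k' _ (svalP (F k'))) in exist (P k'.+1) (sval w) (svalP w).1
  else exist (P 0%N) psi0 psi0P.
exists (fun k => sval (psi k)); split=> // k x /=.
by have [_ ->] := svalP (cid (step k _ (svalP (psi k)))).
Qed.

End BaseChange.

(** * Comparing ranks *)

Section Augmentation.
Variable K : groupType.
Notation ZK := (group_ring int K).

Definition augmentation (u : ZK) : int := u *: (1 : trivial_mod int K).

Lemma augmentation_zmod : zmod_morphism augmentation.
Proof. by move=> u v; rewrite /augmentation scalerBl. Qed.

HB.instance Definition _ := GRing.isZmodMorphism.Build ZK int augmentation augmentation_zmod.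

Lemma trivial_mod_scale u (n : trivial_mod int K) : u *: n = (augmentation u * n : int).
Proof.
elim/group_ring_ind: u => [|u v IHu IHv|g z].
- by rewrite scale0r raddf0 mul0r.
- by rewrite scalerDl raddfD mulrDl IHu IHv.
by rewrite /augmentation !trivial_mod_monomial mulr1.
Qed.

Lemma augmentationM u v : augmentation (u * v) = augmentation u * augmentation v.
Proof. by rewrite {1}/augmentation -scalerA trivial_mod_scale. Qed.

(** Group rings have the invariant basis number property because of their
    augmentation: after augmenting, the coordinates of [q] basis vectors with
    respect to [J] generators factor the identity matrix of size [q] over the
    rationals through [#|J|] dimensions. *)
Lemma leq_generators (M : lmodType ZK) (J : finType) (s : J -> M) (I : choiceType)
    (u : {linear M -> freemod ZK I}) (q : nat) (idx : 'I_q -> I) :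
  (forall m, exists c : J -> ZK, m = \sum_j c j *: s j) ->
  (forall y, exists x, u x = y) -> injective idx -> (q <= #|J|)%N.
Proof.
move=> gen onto inj.
pose x l := sval (cid (onto (delta (idx l) 1))).
have xE l : u (x l) = delta (idx l) 1 by exact: svalP (cid (onto _)).
pose c l := sval (cid (gen (x l))).
have cE l : x l = \sum_j c l j *: s j by exact: svalP (cid (gen _)).
pose P := \matrix_(l < q, i < #|J|) ((augmentation (c l (enum_val i)))%:~R : rat).
pose Q := \matrix_(i < #|J|, l < q)
  ((augmentation (u (s (enum_val i)) (idx l)))%:~R : rat).
have PQ : P *m Q = 1%:M.
  apply/matrixP => k l; rewrite !mxE.
  under eq_bigr do rewrite !mxE -intrM -augmentationM.
  rewrite -rmorph_sum -raddf_sum /=.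
  have -> : \sum_(i < #|J|) c k (enum_val i) * u (s (enum_val i)) (idx l) =
      u (x k) (idx l).
    rewrite cE linear_sum (reindex _ (onW_bij _ (enum_val_bij J))) /= fm_sumE.
    by apply: eq_bigr => i _; rewrite linearZ.
  rewrite xE deltaE (inj_eq inj) eq_sym.
  case: eqVneq => _; last by rewrite raddf0.
  by rewrite [augmentation 1]trivial_mod_monomial.
have := mulmx_max_rank P Q; by rewrite PQ mxrank1.
Qed.

(** The rank of a based module is only known up to isomorphism, whereas norms
    refer to its own basis. The two are compared by bounding the finite subsets of
    the basis, so that finiteness of the basis is part of the conclusion. *)
Lemma basis_leq_rank (I : choiceType) p : has_rank (freemod ZK I : lmodType ZK) p ->
  finite_set [set: I] /\ (#|` fset_set [set: I]| <= p)%N.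
Proof.
move=> [f fbij].
have [h hK Kh] := fbij.
have bound (S : {fset I}) : (#|` S| <= p)%N.
  rewrite -[X in (_ <= X)%N]card_ord.
  apply: (@leq_generators _ _ (fun i => h (delta i 1)) _ idfun _
    (fun l => val (enum_val (cast_ord (cardfE S) l)))).
  - move=> m; exists (fun i => f m i); apply: (bij_inj fbij).
    rewrite linear_sum; apply/fmP => l.
    have fE (a : ZK) i : f (a *: h (delta i 1)) l = if l == i then a else 0.
      rewrite linearZ /= Kh -[a in RHS]mulr1 -deltaE.
      exact: (congr1 (fun y : freemod ZK 'I_p => y l) (delta_scale a i 1)).
    rewrite fm_sumE (bigD1 l) //= fE eqxx big1 ?addr0 // => i il.
    by rewrite fE eq_sym (negPf il).
  - by move=> y; exists y.
  - by move=> k l /val_inj/enum_val_inj/cast_ord_inj.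
have fin : finite_set [set: I].
  case: (pselect (finite_set [set: I])) => // /(infinite_set_fset p.+1)[S _].
  by move=> /leq_trans/(_ (bound S)); rewrite ltnn.
by split=> //; exact: bound.
Qed.

End Augmentation.

Lemma resmod_monomial (G : groupType) (K : groupClosed G)
    (M : lmodType (group_ring int G)) (w : resmod (group_ring_incl K int) M) l z :
  monomial l z *: w = monomial (val l) z *: (w : M).
Proof.
change (group_ring_incl K int (monomial l z) *: (w : M) = monomial (val l) z *: (w : M)).
by congr (_ *: _); exact: crossed_map_delta.
Qed.

(** * Cosets of a finite index subgroup *)

Section Cosets.
Variables (G : groupType) (K : groupClosed G).
Local Open Scope classical_set_scope.

Definition cosets : set (set G) := [set left_coset g K | g in setT].
Hypothesis finK : finite_set cosets.

Definition coset_rep (c : set G) : G := xget 1%g c.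

Lemma coset_repP g : exists2 l, l \in K & coset_rep (left_coset g K) = (g * l)%g.
Proof.
rewrite /coset_rep; case: xgetP => [y _ [l /= lK <-]|/(_ g)]; first by exists l.
by case; exists 1%g => /=; [exact: gpred1|rewrite mulg1].
Qed.

Lemma left_coset_eq g h : (g^-1 * h)%g \in K -> left_coset g K = left_coset h K.
Proof.
move=> gh; apply/seteqP; split=> _ [l /= lK <-].
  exists ((g^-1 * h)^-1 * l)%g; first by rewrite /= gpredM ?gpredV.
  by rewrite invgM invgK !mulgA mulgV mul1g.
by exists ((g^-1 * h) * l)%g; [rewrite /= gpredM|rewrite !mulgA mulgV mul1g].
Qed.

(** Translation by [g] permutes the cosets, and changes the chosen representatives
    only by elements of [K]. *)
Lemma coset_sum_translate (V : nmodType) (F : G -> V) (g : G) :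
  (forall t l, l \in K -> F (t * l)%g = F t) ->
  \sum_(c <- fset_set cosets) F (g * coset_rep c)%g =
  \sum_(c <- fset_set cosets) F (coset_rep c).
Proof.
rewrite -!fsbig_finite // => FK; pose h (c : set G) := [set (g * x)%g | x in c].
have hE t : h (left_coset t K) = left_coset (g * t)%g K.
  apply/seteqP; split=> [_ [_ [l lK <-] <-]|_ [l lK <-]].
    by exists l => //; rewrite mulgA.
  by exists (t * l)%g; [exists l|rewrite mulgA].
rewrite [RHS](@reindex_fsbig _ _ _ _ _ h cosets cosets).
  apply: eq_fsbigr => c; rewrite inE => -[t _ <-]; rewrite hE.
  have [l lK ->] := coset_repP t; have [l' l'K ->] := coset_repP (g * t)%g.
  by rewrite mulgA (FK _ l) ?(FK _ l').
split=> [_ [t _ <-]|c c' _ _ cc'|_ [t _ <-]].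
- by rewrite hE; exists (g * t)%g.
- have E (b : set G) : b = [set (g^-1 * x)%g | x in h b].
    apply/seteqP; split=> [x bx|_ [_ [x bx <-] <-]]; last by rewrite mulKg.
    by exists (g * x)%g; [exists x|rewrite mulKg].
  by rewrite (E c) (E c') cc'.
exists (left_coset (g^-1 * t)%g K); first by exists (g^-1 * t)%g.
by rewrite hE mulVKg.
Qed.

Definition coset_index : nat := #|` fset_set cosets|.

(** A term [z g] is rewritten as an element of [Z[K]] times the inverse of the
    representative [t] of the coset [g^-1 K], since [g t] lies in [K]. *)
Lemma restriction_generators (M : lmodType (group_ring int G)) (n : nat) (s : 'I_n -> M) :
  (forall m, exists c : 'I_n -> group_ring int G, m = \sum_i c i *: s i) ->
  forall m : resmod (group_ring_incl K int) M,
  exists c : fset_set cosets * 'I_n -> group_ring int (subgroup K),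
    m = \sum_j c j *: ((monomial (coset_rep (val j.1))^-1%g 1 : group_ring int G) *: s j.2
        : resmod (group_ring_incl K int) M).
Proof.
move=> gen m.
pose S (j : fset_set cosets * 'I_n) : resmod (group_ring_incl K int) M :=
  (monomial (coset_rep (val j.1))^-1%g 1 : group_ring int G) *: s j.2.
pose spanned (m : resmod (group_ring_incl K int) M) :=
  exists c : fset_set cosets * 'I_n -> group_ring int (subgroup K), m = \sum_j c j *: S j.
have spanned0 : spanned 0.
  by exists (fun=> 0); rewrite big1 // => j _; rewrite scale0r.
have spannedD x y : spanned x -> spanned y -> spanned (x + y).
  move=> [a ->] [b ->]; exists (fun j => a j + b j).
  by rewrite -big_split; apply: eq_bigr => j _; rewrite scalerDl.
have [c ->] := gen m; rewrite -/(spanned _).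
elim/big_ind: _ => // i _; elim/group_ring_ind: (c i) => [|u v IHu IHv|g z].
- by rewrite scale0r.
- by rewrite scalerDl; apply: spannedD.
have cg : left_coset g^-1%g K \in fset_set cosets.
  by rewrite in_fset_set // inE; exists g^-1%g.
have [l lK lE] := coset_repP g^-1%g.
pose j0 : fset_set cosets * 'I_n := ([` cg]%fset, i).
exists (fun j => if j == j0 then monomial (Sub l lK : subgroup K) z else 0).
rewrite (bigD1 j0) //= eqxx big1 ?addr0 => [|j /negPf ->]; last by rewrite scale0r.
rewrite /S /= lE resmod_monomial.
by rewrite scalerA monomialM mulr1 invgM invgK mulVKg.
Qed.

Lemma restriction_rank (M : lmodType (group_ring int G)) (n : nat) (s : 'I_n -> M) q :
  (forall m, exists c : 'I_n -> group_ring int G, m = \sum_i c i *: s i) ->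
  has_rank (resmod (group_ring_incl K int) M) q -> (q <= coset_index * n)%N.
Proof.
move=> gen [f [h hK Kh]].
have := leq_generators (u := f) (idx := idfun : 'I_q -> 'I_q)
  (restriction_generators gen) (fun y => ex_intro _ (h y) (Kh y)) (fun _ _ => id).
by rewrite card_prod card_ord /coset_index cardfE.
Qed.

End Cosets.

(** * The complex induced to the crossed product *)

Section Induced.
Variables (G : groupType) (d : measure_display) (X : measurableType d).
Variables (R : realType) (mu : probability X R) (alpha : free_pmp_action G mu).
Variables (Z : comPzRingType) (N : normed_ring R Z).
Variables (K : groupClosed G) (Y : set X).
Local Open Scope classical_set_scope.
Hypothesis mY : measurable Y.
Hypothesis YK : forall l, l \in K -> alpha l @^-1` Y = Y.

Notation ZK := (group_ring int (subgroup K)).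
Notation CR := (crossed_ring alpha N).
Notation coefs := (coefmod (Linfty_action alpha N)).

Definition translation (g : G) : CR := delta g 1.
Definition chiY : CR := chi alpha N mY.

Lemma translationM g h : translation (g * h)%g = translation g * translation h.
Proof. by rewrite [RHS]cp_mul_delta mul1r rmorph1. Qed.

Let intr_equiv (l : subgroup K) (z : int) :
  z%:~R = Linfty_action alpha N (val l) (z%:~R) :> Linfty mu N.
Proof. by rewrite rmorph_int. Qed.

Definition subgroup_pair : equivariant_pair (trivial_action int (subgroup K))
    (Linfty_action alpha N) :=
  @EquivariantPair _ _ _ _ (trivial_action int (subgroup K)) (Linfty_action alpha N)
    (intr : {rmorphism int -> Linfty mu N}) val erefl (fun _ _ => erefl) intr_equiv.

Definition subgroup_ring_map : {rmorphism ZK -> CR} := crossed_map subgroup_pair.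
Notation j := subgroup_ring_map.

Lemma subgroup_ring_map_monomial l z : j (monomial l z) = delta (val l) (z%:~R).
Proof. exact: crossed_map_delta. Qed.

(** This is where the invariance of [Y] under [K] enters: it makes the ideal [<Y>]
    stable under right multiplication by [Z[K]], so that a matrix over [Z[K]]
    defines a map between sums of copies of [<Y>]. *)
Lemma chiY_comm u : chiY * j u = j u * chiY.
Proof.
elim/group_ring_ind: u => [|u v IHu IHv|l z]; first by rewrite rmorph0 mulr0 mul0r.
  by rewrite rmorphD mulrDr IHu IHv mulrDl.
rewrite subgroup_ring_map_monomial [LHS]cp_mul_delta [RHS]cp_mul_delta mul1g mulg1.
rewrite rmorph_int mulrC; congr (delta _ (_ * _)).
rewrite [RHS]LactE; congr Lcls; apply/val_inj/funext => x /=.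
rewrite !indicE; congr (_%:R); congr nat_of_bool; apply/idP/idP; rewrite !inE.
  by rewrite -{1}(@YK (val l)^-1%g) // gpredV; exact: valP.
by rewrite -{2}(@YK (val l)^-1%g) // gpredV; exact: valP.
Qed.

Definition block (I : finType) : marked X := @Marked _ X I (fun=> Y) (fun=> mY).
Notation bmod I := (marked_mod alpha N (block I)).

Section RightMultiplication.
Variables (I J : finType) (m : I -> J -> ZK).

(** The map [CR chiY (x) ZK^I -> CR chiY (x) ZK^J] induced by the matrix [m], in
    coordinates; tensor products over [ZK] are thereby avoided. *)
Definition rmul_fun (x : bmod I) (b : J) : CR := \sum_a x a * j (m a b).

Lemma rmul_fun_in (x : bmod I) : @in_marked _ _ _ _ _ alpha _ N (block J) (rmul_fun x).
Proof.
have /asboolP xI := mm_valP x; apply/asboolP => b.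
pose y a : CR := sval (cid (xI a)).
have yE a : x a = y a * chiY by exact: svalP (cid (xI a)).
exists (\sum_a y a * j (m a b)); rewrite mulr_suml; apply: eq_bigr => a _.
by rewrite yE -!mulrA chiY_comm.
Qed.

Definition rmul (x : bmod I) : bmod J := MarkedMod (rmul_fun_in x).

Lemma rmul_is_linear : linear rmul.
Proof.
move=> a x y; apply/val_inj/funext => b.
change (rmul_fun (a *: x + y) b = a * rmul_fun x b + rmul_fun y b).
rewrite /rmul_fun mulr_sumr -big_split; apply: eq_bigr => i _ /=.
by rewrite mulrA -mulrDl.
Qed.

HB.instance Definition _ := GRing.isLinear.Build CR (bmod I) (bmod J) *:%R rmul rmul_is_linear.
End RightMultiplication.

Lemma rmul_rmul (I J I' : finType) (m : I -> J -> ZK) (m' : J -> I' -> ZK) x b :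
  rmul m' (rmul m x) b = \sum_a x a * j (\sum_i m a i * m' i b).
Proof.
transitivity (\sum_i (\sum_a x a * j (m a i)) * j (m' i b)); first by [].
under eq_bigr do rewrite mulr_suml.
rewrite exchange_big; apply: eq_bigr => a _ /=.
by rewrite rmorph_sum mulr_sumr; apply: eq_bigr => i _; rewrite rmorphM mulrA.
Qed.

Section AugmentationMap.
Variables (I : finType) (e : I -> int).

Definition block_aug (x : bmod I) : coefs := \sum_a (x a : CR) *: ((e a)%:~R : coefs).

Lemma block_aug_is_linear : linear block_aug.
Proof.
move=> a x y; rewrite /block_aug scaler_sumr -big_split; apply: eq_bigr => i _ /=.
by rewrite scalerA -scalerDl.
Qed.

HB.instance Definition _ :=
  GRing.isLinear.Build CR (bmod I) coefs *:%R block_aug block_aug_is_linear.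
End AugmentationMap.

Lemma subgroup_ring_map_scale (u : ZK) (n : int) :
  j u *: (n%:~R : coefs) = (augmentation u * n)%:~R.
Proof.
elim/group_ring_ind: u => [|u v IHu IHv|l z].
- by rewrite !raddf0 scale0r mul0r.
- by rewrite !raddfD /= scalerDl IHu IHv mulrDl intrD.
rewrite subgroup_ring_map_monomial [LHS]cp_scale_delta rmorph_int -intrM.
by rewrite /augmentation trivial_mod_monomial mulr1.
Qed.

Lemma block_aug_rmul (I J : finType) (m : I -> J -> ZK) (e : J -> int) x :
  block_aug e (rmul m x) =
  \sum_a (x a : CR) *: ((\sum_i augmentation (m a i) * e i)%:~R : coefs).
Proof.
transitivity (\sum_i (\sum_a x a * j (m a i)) *: ((e i)%:~R : coefs)); first by [].
under eq_bigr do rewrite scaler_suml.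
rewrite exchange_big; apply: eq_bigr => a _ /=.
rewrite rmorph_sum scaler_sumr; apply: eq_bigr => i _.
by rewrite -scalerA subgroup_ring_map_scale.
Qed.

(** * The transfer map *)

Hypothesis finK : finite_set (cosets K).

Section Transfer.
Variables (M : lmodType (group_ring int G)) (J : choiceType).
Variable f : {linear resmod (group_ring_incl K int) M -> freemod ZK J}.

Definition transfer_term (t : G) (x : M) (b : J) : CR :=
  translation t * chiY * j (f (monomial t^-1%g 1 *: x) b).

Lemma transfer_termD t x y b :
  transfer_term t (x + y) b = transfer_term t x b + transfer_term t y b.
Proof.
rewrite /transfer_term scalerDr.
have -> : f (monomial t^-1%g 1 *: x + monomial t^-1%g 1 *: y) =
   f (monomial t^-1%g 1 *: x) + f (monomial t^-1%g 1 *: y) by exact: linearD.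
by rewrite fmD raddfD mulrDr.
Qed.

(** An element of [K] moved out of the translation passes [chiY] and is absorbed by
    the equivariance of [f], so the summand depends only on the coset [t K]. *)
Lemma transfer_termK x b t l : l \in K -> transfer_term (t * l)%g x b = transfer_term t x b.
Proof.
move=> lK; rewrite /transfer_term translationM.
have jl : translation l = j (monomial (Sub l lK : subgroup K) 1).
  by rewrite subgroup_ring_map_monomial.
rewrite jl -[translation t * _ * _]mulrA -chiY_comm -!mulrA -rmorphM; congr (_ * (_ * j _)).
pose w : resmod (group_ring_incl K int) M := monomial t^-1%g 1 *: x.
have -> : monomial (t * l)^-1%g 1 *: x = monomial (Sub l lK : subgroup K)^-1%g 1 *: w.
  by rewrite resmod_monomial scalerA monomialM mulr1 invgM.
by rewrite linearZ_LR fmZ mulrA monomialM mulgV mulr1 mul1r.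
Qed.

Lemma transfer_term_translate g t x b :
  transfer_term (g * t)%g (monomial g 1 *: x) b = translation g * transfer_term t x b.
Proof.
rewrite /transfer_term translationM scalerA monomialM invgM mulgVK mulr1.
by rewrite -!mulrA.
Qed.

Variable B : {fset J}.

Definition transfer_fun (x : M) (b : B) : CR :=
  \sum_(c <- fset_set (cosets K)) transfer_term (coset_rep c) x (val b).

Lemma transfer_fun_in x : @in_marked _ _ _ _ _ alpha _ N (block B) (transfer_fun x).
Proof.
apply/asboolP => b; rewrite /transfer_fun.
exists (\sum_(c <- fset_set (cosets K)) translation (coset_rep c) *
  j (f (monomial (coset_rep c)^-1%g 1 *: x) (val b))).
by rewrite mulr_suml; apply: eq_bigr => c _; rewrite /transfer_term -!mulrA chiY_comm.
Qed.

(** The transfer [x |-> \sum_(t K) t chiY (x) f (t^-1 x)], written in coordinates. It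
    turns a map that is equivariant under [K] only into one that is equivariant
    under [G]. *)
Definition transfer (x : M) : bmod B := MarkedMod (transfer_fun_in x).

Lemma transferE x b : transfer x b =
  \sum_(c <- fset_set (cosets K)) transfer_term (coset_rep c) x (val b).
Proof. by []. Qed.

Lemma transfer_is_zmod : zmod_morphism transfer.
Proof.
have tD x y : transfer (x + y) = transfer x + transfer y.
  apply/val_inj/funext => b; change (transfer (x + y) b = transfer x b + transfer y b).
  rewrite !transferE -big_split; apply: eq_bigr => c _; exact: transfer_termD.
move=> x y; rewrite tD; congr (_ + _); apply: (addIr (transfer y)); rewrite -tD !addNr.
by apply: (addIr (transfer 0)); rewrite -tD !add0r.
Qed.

HB.instance Definition _ := GRing.isZmodMorphism.Build M (bmod B) transfer transfer_is_zmod.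

Lemma transfer_translate g x : transfer (monomial g 1 *: x) = translation g *: transfer x.
Proof.
apply/val_inj/funext => b.
change (transfer (monomial g 1 *: x) b = translation g * transfer x b).
rewrite !transferE mulr_sumr.
rewrite -(@coset_sum_translate _ _ finK _
  (fun t => transfer_term t (monomial g 1 *: x) (val b)) g) => [|t l lK].
  by apply: eq_bigr => c _; rewrite transfer_term_translate.
exact: transfer_termK.
Qed.

End Transfer.

Definition matrix_of (J J' : choiceType) (u : {linear freemod ZK J -> freemod ZK J'})
    (B : {fset J}) (B' : {fset J'}) (a : B) (b : B') : ZK :=
  u (delta (val a) 1) (val b).

Lemma freemod_expand (J : choiceType) (B : {fset J}) (y : freemod ZK J) :
  (forall a, a \in B) -> y = \sum_(a : B) y (val a) *: delta (val a) 1.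
Proof.
move=> Bfull; apply/fmP => i; rewrite fm_sumE (bigD1 [` Bfull i]%fset) // big1 => [|a ai].
  by rewrite delta_scale deltaE /= eqxx mulr1 addr0.
rewrite delta_scale deltaE; case: eqP => // ia; case/eqP: ai; exact: val_inj.
Qed.

Lemma linear_coord (J J' : choiceType) (u : {linear freemod ZK J -> freemod ZK J'})
    (B : {fset J}) y b : (forall a, a \in B) ->
  u y b = \sum_(a : B) y (val a) * u (delta (val a) 1) b.
Proof.
move=> Bfull; rewrite {1}(freemod_expand y Bfull) linear_sum fm_sumE.
by apply: eq_bigr => a _; rewrite linearZ_LR fmZ.
Qed.

Lemma transfer_chain (M M' : lmodType (group_ring int G)) (dM : {linear M -> M'})
    (J J' : choiceType) (u : {linear freemod ZK J -> freemod ZK J'})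
    (f : {linear resmod (group_ring_incl K int) M -> freemod ZK J})
    (f' : {linear resmod (group_ring_incl K int) M' -> freemod ZK J'})
    (B : {fset J}) (B' : {fset J'}) x :
  (forall a, a \in B) -> (forall x : M, u (f x) = f' (dM x)) ->
  rmul (matrix_of u (B := B) (B' := B')) (transfer f B x) = transfer f' B' (dM x).
Proof.
move=> Bfull uf; apply/val_inj/funext => b.
transitivity (\sum_(a : B) (transfer f B x) a * j (u (delta (val a) 1) (val b))).
  by [].
under eq_bigr do rewrite transferE mulr_suml.
rewrite exchange_big /=; apply: eq_bigr => c _.
rewrite /transfer_term -linearZ /= -uf (linear_coord _ _ _ Bfull) rmorph_sum mulr_sumr.
by apply: eq_bigr => a _; rewrite rmorphM mulrA.
Qed.

(** * Translates of [Y] *)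

Hypothesis Ycover : forall x, exists g, Y (alpha g^-1%g x).
Hypothesis Ydisj : forall x g h,
  Y (alpha g^-1%g x) -> Y (alpha h^-1%g x) -> (g^-1 * h)%g \in K.

Lemma unique_coset x : exists2 c0, c0 \in fset_set (cosets K) &
  forall c, c \in fset_set (cosets K) -> Y (alpha (coset_rep c)^-1%g x) <-> c = c0.
Proof.
have [g gY] := Ycover x; exists (left_coset g K).
  by rewrite in_fset_set // inE; exists g.
move=> c; rewrite in_fset_set // inE => -[h _ <-].
have [l lK ->] := coset_repP K h; split=> [/(Ydisj gY) ghK|/esym gh].
  apply/esym/left_coset_eq; rewrite -[(_ * h)%g](mulgK l) -[(_ * h * l)%g]mulgA.
  by rewrite gpredM // gpredV.
have [l' l'K] : left_coset g K (h * l)%g by rewrite gh; exists l.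
move=> <-; rewrite invgM paM; change ((alpha l'^-1%g @^-1` Y) (alpha g^-1%g x)).
by rewrite YK // gpredV.
Qed.

Lemma translation_chiY t : translation t * chiY *: (1 : coefs) =
  Lcls (bm_translate alpha t^-1%g (BMFun (indic_bm mu N mY))).
Proof.
rewrite -scalerA [chiY *: _]cp_scale_delta rmorph1 mulr1.
by rewrite [LHS]cp_scale_delta mul1r [LHS]LactE.
Qed.

Lemma partition_of_unity :
  \sum_(c <- fset_set (cosets K)) translation (coset_rep c) * chiY *: (1 : coefs) = 1.
Proof.
under eq_bigr do rewrite translation_chiY.
have LclsS (r : seq (set G)) (F : set G -> bmfun mu N) :
    \sum_(c <- r) Lcls (F c) = Lcls (\sum_(c <- r) F c).
  by elim/big_rec2: _ => // c y1 y2 _ ->; rewrite -LclsD.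
rewrite [LHS]LclsS; congr Lcls; apply/val_inj/funext => x /=.
have ev (r : seq (set G)) (F : set G -> bmfun mu N) :
    (\sum_(c <- r) F c) x = \sum_(c <- r) F c x.
  by elim/big_rec2: _ => // c y1 y2 _ <-.
rewrite [LHS]ev; have [c0 c0Q c0P] := unique_coset x.
rewrite (bigD1_seq c0) //= indicE mem_set ?big1_seq ?addr0 //; last exact/c0P.
move=> c /andP[cc0 cQ]; rewrite /= indicE memNset // => /c0P -/(_ cQ) E.
by rewrite E eqxx in cc0.
Qed.

(** The augmentation of [x] is picked up once for each coset, weighted with the
    characteristic function of the corresponding translate of [Y]; the translates
    partition [X]. *)
Lemma transfer_aug (M : lmodType (group_ring int G)) (eps : M -> int)
    (J : choiceType) (e : {linear freemod ZK J -> trivial_mod int (subgroup K)})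
    (f : {linear resmod (group_ring_incl K int) M -> freemod ZK J})
    (B : {fset J}) x :
  (forall a, a \in B) -> (forall x : M, e (f x) = eps x) ->
  (forall g x, eps (monomial g 1 *: x) = eps x) ->
  block_aug (fun a : B => e (delta (val a) 1)) (transfer f B x) = (eps x)%:~R.
Proof.
move=> Bfull ef epsG.
have sumE (t : G) :
    \sum_(a : B) transfer_term f t x (val a) *: ((e (delta (val a) 1) : int)%:~R : coefs) =
    (translation t * chiY *: (1 : coefs)) *~ eps x.
  under eq_bigr do rewrite /transfer_term -scalerA subgroup_ring_map_scale.
  rewrite -scaler_sumr -rmorph_sum /= -scalerMzr; congr (_ *~ _).
  rewrite -(epsG t^-1%g x) -ef
    [RHS](congr1 e (freemod_expand (f (monomial t^-1%g 1 *: x)) Bfull)) linear_sum.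
  by apply: eq_bigr => a _; rewrite linearZ_LR trivial_mod_scale.
transitivity (\sum_(a : B) transfer f B x a *: ((e (delta (val a) 1) : int)%:~R : coefs)).
  by [].
under eq_bigr do rewrite transferE scaler_suml.
rewrite exchange_big /=; under eq_bigr do rewrite sumE.
by rewrite -mulrz_suml partition_of_unity.
Qed.

Local Open Scope ereal_scope.

Lemma measure_coset : (coset_index K)%:R%:E * mu Y = 1.
Proof.
rewrite -(probability_setT mu).
have -> : [set: X] =
    \bigcup_(c in cosets K) (alpha (coset_rep c)^-1%g @^-1` Y).
  apply/seteqP; split=> // x _; have [c0 c0Q c0P] := unique_coset x.
  by exists c0; [move: c0Q; rewrite in_fset_set // inE|apply/c0P].
rewrite measure_fin_bigcup //.
- rewrite fsbig_finite //=; under eq_bigr do rewrite pa_preserving //.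
  rewrite -[mu Y]fineK ?fin_num_measure // sumEFin big_const_seq count_predT.
  by rewrite iter_addr_0 -EFinM mulr_natl.
- move=> c c' cQ c'Q [x [xc xc']]; have [c0 c0Q c0P] := unique_coset x.
  have inQ b : cosets K b -> b \in fset_set (cosets K).
    by move=> bQ; rewrite in_fset_set // inE.
  by rewrite ((c0P c (inQ _ cQ)).1 xc) ((c0P c' (inQ _ c'Q)).1 xc').
- by move=> c _; rewrite -[_ @^-1` _]setTI; exact: pa_measurable.
Qed.

End Induced.

(** * Norm estimates *)

Section LinftyNorm.
Variables (d : measure_display) (X : measurableType d).
Variables (R : realType) (mu : probability X R).
Variables (Z : comPzRingType) (N : normed_ring R Z).
Local Open Scope ereal_scope.

Definition L1norm (f : Linfty mu N) : \bar R := \int[mu]_t (N (repr f t))%:E.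

Lemma measurable_norm (h : bmfun mu N) : measurable_fun setT (fun t => (N (h t))%:E).
Proof.
apply/measurable_EFinP => _ A mA; rewrite setTI.
by have /asboolP[mh _] := bm_funP h; exact: (mh (N @^-1` A)%classic).
Qed.

Lemma L1norm_Lcls (h : bmfun mu N) : L1norm (Lcls h) = \int[mu]_t (N (h t))%:E.
Proof.
apply: ge0_ae_eq_integral => //.
- exact: measurable_norm.
- exact: measurable_norm.
- by move=> t _; rewrite lee_fin nr_ge0.
- by move=> t _; rewrite lee_fin nr_ge0.
by apply: filterS (repr_Lcls h) => t ht _; rewrite ht.
Qed.

Lemma L1norm_ge0 f : 0 <= L1norm f.
Proof. by apply: integral_ge0 => t _; rewrite lee_fin nr_ge0. Qed.

Lemma L1normD f g : L1norm (f + g)%R <= L1norm f + L1norm g.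
Proof.
elim/Linfty_ind: f => f; elim/Linfty_ind: g => g.
rewrite -LclsD !L1norm_Lcls -ge0_integralD //; last 4 first.
- by move=> t _; rewrite lee_fin nr_ge0.
- exact: measurable_norm.
- by move=> t _; rewrite lee_fin nr_ge0.
- exact: measurable_norm.
apply: ge0_le_integral => //.
- by move=> t _; rewrite lee_fin nr_ge0.
- exact: measurable_norm.
- by apply: emeasurable_funD; exact: measurable_norm.
by move=> t _; rewrite -EFinD lee_fin; exact: nrD.
Qed.

Lemma L1norm0 : L1norm 0%R = 0.
Proof.
rewrite [L1norm _](L1norm_Lcls 0%R) integral0_eq // => t _.
by congr (_%:E); apply/(nr_eq0 N).
Qed.

Lemma L1normN f : L1norm (- f)%R = L1norm f.
Proof.
elim/Linfty_ind: f => f; rewrite -[(- _)%R]sub0r -LclsB !L1norm_Lcls.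
apply: eq_integral => t _; congr (_%:E).
change (N (0 - f t) = N (f t))%R; by rewrite sub0r nrN.
Qed.

(** Multiplication by the image of an integer is repeated addition, so this is the
    triangle inequality. *)
Lemma L1norm_intr f (z : int) : L1norm (f * z%:~R)%R <= (`|z|%:~R)%:E * L1norm f.
Proof.
have nat_case n : L1norm (f *+ n)%R <= (n%:R)%:E * L1norm f.
  elim: n => [|n IHn]; first by rewrite mulr0n mul0e L1norm0.
  rewrite mulrS -[n.+1]add1n natrD EFinD ge0_muleDl ?lee_fin // mul1e.
  by apply: le_trans (L1normD _ _) _; rewrite leeD2l.
rewrite mulrzr; case: z => n.
  by rewrite -pmulrn; apply: le_trans (nat_case n) _.
rewrite NegzE mulrNz L1normN -pmulrn normrN; exact: nat_case.
Qed.

End LinftyNorm.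

Section CrossedNorm.
Variables (G : groupType) (d : measure_display) (X : measurableType d).
Variables (R : realType) (mu : probability X R) (alpha : free_pmp_action G mu).
Variables (Z : comPzRingType) (N : normed_ring R Z).
Local Open Scope ereal_scope.
Notation CR := (crossed_ring alpha N).

Lemma crossed_norm_fset (S : {fset G}) (x : CR) :
  (forall g, g \notin S -> (x : freemod _ _) g = 0%R) ->
  crossed_norm x = \sum_(g <- S) L1norm ((x : freemod (Linfty mu N) G) g).
Proof. by move=> xS; apply: fsbigTE => g /xS ->; exact: L1norm0. Qed.

Lemma crossed_norm_ge0 (x : CR) : 0 <= crossed_norm x.
Proof.
rewrite (@crossed_norm_fset (fsupp x)) => [|g]; last exact: notin_fsupp.
by apply: sume_ge0 => g _; exact: L1norm_ge0.
Qed.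

Lemma crossed_normD (x y : CR) :
  crossed_norm (x + y)%R <= crossed_norm x + crossed_norm y.
Proof.
set S := (fsupp x `|` fsupp y)%fset.
have xS g : g \notin S -> (x : freemod _ _) g = 0%R.
  by rewrite in_fsetU negb_or => /andP[/notin_fsupp].
have yS g : g \notin S -> (y : freemod _ _) g = 0%R.
  by rewrite in_fsetU negb_or => /andP[_ /notin_fsupp].
rewrite (crossed_norm_fset xS) (crossed_norm_fset yS) (@crossed_norm_fset S) => [|g gS].
  by rewrite -big_split; apply: lee_sum => g _; exact: L1normD.
by rewrite fmD xS // yS // addr0.
Qed.

Lemma crossed_norm_delta g a : crossed_norm (delta g a : CR) = L1norm a.
Proof.
rewrite (@crossed_norm_fset [fset g]%fset) => [|h].
  by rewrite big_seq_fset1 deltaE eqxx.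
by rewrite in_fset1 deltaE => /negPf ->.
Qed.

Lemma crossed_norm0 : crossed_norm (0 : CR) = 0.
Proof. by rewrite (@crossed_norm_fset fset0) ?big_seq_fset0. Qed.

Lemma crossed_norm_sum (T : Type) (r : seq T) (F : T -> CR) :
  crossed_norm (\sum_(i <- r) F i)%R <= \sum_(i <- r) crossed_norm (F i).
Proof.
elim/big_rec2: _ => [|i y1 y2 _ IH]; first by rewrite crossed_norm0.
by apply: le_trans (crossed_normD _ _) _; rewrite leeD2l.
Qed.

Lemma crossed_norm_mul_delta (x : CR) (g : G) (z : int) :
  crossed_norm (x * (delta g z%:~R : CR))%R <= (`|z|%:~R)%:E * crossed_norm x.
Proof.
have -> : (x * (delta g z%:~R : CR) = \sum_(h <- fsupp x)
    (delta (h * g)%g ((x : freemod _ _) h * z%:~R) : CR))%R.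
  have {1}-> : x = (\sum_(h <- fsupp x) (delta h ((x : freemod _ _) h) : CR))%R.
    exact: fm_decomp.
  rewrite mulr_suml; apply: eq_bigr => h _; rewrite [LHS]cp_mul_delta.
  by rewrite rmorph_int.
apply: le_trans (crossed_norm_sum _ _) _.
rewrite (@crossed_norm_fset (fsupp x) x) => [|h]; last exact: notin_fsupp.
rewrite ge0_sume_distrr; last by move=> h _; exact: L1norm_ge0.
apply: lee_sum => h _; rewrite crossed_norm_delta; exact: L1norm_intr.
Qed.

Variables (K : groupClosed G) (Y : set X).
Hypothesis mY : measurable Y.
Hypothesis YK : forall l, l \in K -> (alpha l @^-1` Y)%classic = Y.
Notation ZK := (group_ring int (subgroup K)).
Notation j := (subgroup_ring_map alpha N K).

Definition group_ring_l1 (u : ZK) : R :=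
  (\sum_(g \in [set: subgroup K]) (`|(u : freemod int _) g|%:~R : R))%R.

Lemma group_ring_l1E u :
  group_ring_l1 u = (\sum_(g <- fsupp u) (`|(u : freemod int _) g|%:~R : R))%R.
Proof. by apply: fsbigTE => g /notin_fsupp ->; rewrite normr0. Qed.

Lemma crossed_norm_mul (x : CR) (u : ZK) :
  crossed_norm (x * j u)%R <= (group_ring_l1 u)%:E * crossed_norm x.
Proof.
have -> : (j u = \sum_(g <- fsupp u) (delta (val g) (u g)%:~R : CR))%R.
  rewrite {1}(fm_decomp u) rmorph_sum; apply: eq_bigr => g _.
  exact: subgroup_ring_map_monomial.
rewrite mulr_sumr group_ring_l1E; apply: le_trans (crossed_norm_sum _ _) _.
rewrite -sumEFin ge0_sume_distrl; last by move=> g _; rewrite lee_fin ler0z.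
by apply: lee_sum => g _; exact: crossed_norm_mul_delta.
Qed.

(** Right multiplication by a group element moves the coefficients of an element of
    the crossed product to other group elements without changing them. So the
    [l^1]-norms of the rows bound the map, as they do over [Z[K]]. *)
Lemma marked_norm_rmul (I J : finType) (m : I -> J -> ZK) (c : R) :
  (forall a, (\sum_b group_ring_l1 (m a b) <= c)%R) ->
  forall x, marked_norm (rmul (mY := mY) YK m x : marked_mod alpha N _) <=
    c%:E * marked_norm x.
Proof.
move=> mc x; rewrite /marked_norm.
apply: (@le_trans _ _ (\sum_b \sum_a (group_ring_l1 (m a b))%:E * crossed_norm (x a))).
  apply: lee_sum => b _; apply: le_trans (crossed_norm_sum _ _) _.
  by apply: lee_sum => a _; exact: crossed_norm_mul.
rewrite exchange_big ge0_sume_distrr /=; last by move=> a _; exact: crossed_norm_ge0.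
apply: lee_sum => a _; rewrite -ge0_sume_distrl => [|b _]; last first.
  by rewrite lee_fin group_ring_l1E; apply: sumr_ge0 => g _; rewrite ler0z.
by rewrite sumEFin lee_wpmul2r ?crossed_norm_ge0 // lee_fin.
Qed.

Lemma l1norm_fset (J : choiceType) (B : {fset J}) (y : freemod ZK J) :
  (forall b, b \in B) -> l1norm R y = (\sum_(b : B) group_ring_l1 (y (val b)))%:E.
Proof.
move=> Bfull; congr (_%:E).
by rewrite (@fsbigTE _ _ _ _ B) ?big_seq_fsetE // => b; rewrite Bfull.
Qed.

Lemma l1norm_basis (J : choiceType) (B : {fset J}) a :
  (forall b, b \in B) -> l1norm R (delta a 1 : freemod ZK J) = 1.
Proof.
move=> Bfull; rewrite (l1norm_fset _ Bfull); congr (_%:E).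
have oneE g : (1%R : ZK) g = if g == 1%g then 1%R else 0%R by exact: deltaE.
rewrite (bigD1 [` Bfull a]%fset) // big1 => [|b ba].
  rewrite [X in group_ring_l1 X]deltaE /= eqxx /group_ring_l1 (@fsbigTE _ _ _ _ [fset 1%g]%fset).
    by rewrite big_seq_fset1 oneE eqxx normr1 addr0.
  by move=> g; rewrite in_fset1 oneE => /negPf ->; rewrite normr0.
rewrite [X in group_ring_l1 X]deltaE; case: eqP => [ab|_]; first by case/eqP: ba; exact: val_inj.
by rewrite group_ring_l1E big1 // => g _; rewrite normr0.
Qed.

(** On the [Z[K]]-side the row norms are the norms of the images of basis elements,
    so each bound for [u] is a bound for the induced map. *)
Lemma opnorm_rmul (J J' : choiceType) (u : {linear freemod ZK J -> freemod ZK J'})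
    (B : {fset J}) (B' : {fset J'}) :
  (forall b, b \in B) -> (forall b, b \in B') ->
  marked_opnorm (rmul (alpha := alpha) (N := N) (mY := mY) YK (matrix_of u (B := B) (B' := B')))
  <= opnorm (@l1norm R _ J) (@l1norm R _ J') u.
Proof.
move=> Bfull Bfull'; apply: ereal_inf_le_tmp => _ [c [c0 cu] <-]; exists c => //.
split=> // x; apply: marked_norm_rmul => a.
have := cu (delta (val a) 1); rewrite (l1norm_basis _ Bfull) mule1.
by rewrite (l1norm_fset _ Bfull') lee_fin.
Qed.

End CrossedNorm.

(** * The embedding of a resolution into the induced complex *)

Section InducedComplex.
Variables (G : groupType) (d : measure_display) (X : measurableType d).
Variables (R : realType) (mu : probability X R) (alpha : free_pmp_action G mu).
Variables (Z : comPzRingType) (N : normed_ring R Z).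
Variables (K : groupClosed G) (Y : set X).
Local Open Scope classical_set_scope.
Hypothesis mY : measurable Y.
Hypothesis YK : forall l, l \in K -> alpha l @^-1` Y = Y.
Hypothesis finK : finite_set (cosets K).
Hypothesis Ycover : forall x, exists g, Y (alpha g^-1%g x).
Hypothesis Ydisj : forall x g h,
  Y (alpha g^-1%g x) -> Y (alpha h^-1%g x) -> (g^-1 * h)%g \in K.

Notation ZK := (group_ring int (subgroup K)).
Notation CR := (crossed_ring alpha N).
Notation coefs := (coefmod (Linfty_action alpha N)).
Notation incl := (group_ring_incl K int).

Variables (C : free_resolution int G) (E : based_complex ZK).
Notation ResC := (res_complex incl C).
Variables (f : forall k, {linear ResC k -> E k}) (g : forall k, {linear E k -> ResC k}).
Variable H : forall k, {linear ResC k -> ResC k.+1}.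
Hypothesis retract : is_homotopy_retract f g H.
Variable n : nat.
Hypothesis finE : forall k, (k <= n.+1)%N -> finite_set [set: bc_basis E k].

(** The retract [E] need not be exact; it is augmented through [g]. *)
Definition induced_aug_fun (y : freemod ZK (bc_basis E 0)) : trivial_mod int (subgroup K) :=
  int_aug (g 0%N y : freemod _ (bc_basis C 0)).

Lemma induced_aug_is_linear : linear induced_aug_fun.
Proof.
move=> u x y; rewrite /induced_aug_fun [g _ _]linearP.
pose w : C 0%N := g 0%N x.
have -> : int_aug (u *: g 0%N x + g 0%N y : ResC 0%N) = int_aug (incl u *: w) +
   int_aug (g 0%N y : C 0%N) by exact: (raddfD (fr_aug C)).
congr (_ + _); have -> : int_aug (incl u *: w) = incl u *: (int_aug w : trivial_mod int G).
  exact: (linearZ_LR (fr_aug C)).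
elim/group_ring_ind: u => [|u v IHu IHv|l z].
- by rewrite raddf0 !scale0r.
- by rewrite raddfD /= !scalerDl IHu IHv.
have -> : incl (monomial l z) = monomial (val l) z by exact: crossed_map_delta.
by rewrite !trivial_mod_monomial.
Qed.

HB.instance Definition _ := GRing.isLinear.Build ZK (freemod ZK (bc_basis E 0))
  (trivial_mod int (subgroup K)) *:%R induced_aug_fun induced_aug_is_linear.

Definition induced_aug : {linear freemod ZK (bc_basis E 0) -> trivial_mod int (subgroup K)} :=
  induced_aug_fun.

Lemma int_aug_d x : int_aug (bc_d C 0 x) = 0.
Proof. by apply/(@fr_exact0 _ _ C); exists x. Qed.

Lemma induced_aug_d y : induced_aug (bc_d E 0 y) = 0.
Proof.
have [_ gc _ _] := retract.
by rewrite /= /induced_aug_fun -(gc 0%N y); exact: int_aug_d.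
Qed.

(** The homotopy [g f ~ id] moves a point by a boundary. *)
Lemma induced_aug_f (x : C 0%N) : induced_aug (f 0%N x) = int_aug x.
Proof.
have [_ _ /(_ x) hx _] := retract; apply/eqP; rewrite -subr_eq0; apply/eqP.
have : int_aug (g 0%N (f 0%N x) - x : C 0%N) = 0 by rewrite -[X in int_aug X]hx; exact: int_aug_d.
by move<-; apply/esym; exact: (raddfB (fr_aug C)).
Qed.

(** Marked modules have finitely many summands, which is guaranteed for [E] up to
    degree [n.+1] only; the complex is zero above. *)
Definition cut_basis k : {fset bc_basis E k} :=
  if (k <= n.+1)%N then fset_set [set: bc_basis E k] else fset0.

Lemma cut_basis_full k a : (k <= n.+1)%N -> a \in cut_basis k.
Proof. by move=> kn; rewrite /cut_basis kn in_fset_set ?inE //; exact: finE. Qed.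

Lemma cut_basis_le k (a : cut_basis k) : (k <= n.+1)%N.
Proof. by case: a => a; rewrite /cut_basis; case: ifP. Qed.

Definition induced_mod k : marked X := block mY (cut_basis k).

Definition induced_d k : {linear marked_mod alpha N (induced_mod k.+1) ->
    marked_mod alpha N (induced_mod k)} :=
  rmul YK (matrix_of (bc_d E k) (B := cut_basis k.+1) (B' := cut_basis k)).

Lemma induced_dd k x : induced_d k (induced_d k.+1 x) = 0.
Proof.
apply/val_inj/funext => b; rewrite [LHS]rmul_rmul big1 // => a _.
(* The existence of [a] forces the degree to be at most [n.+1], so that the basis in
   the middle is complete. *)
have kn := cut_basis_le a; rewrite /matrix_of.
rewrite -(@linear_coord _ _ _ _ (bc_d E k) _ (bc_d E k.+1 (delta (val a) 1))) => [|i].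
  by rewrite bc_dd rmorph0 mulr0.
by apply: cut_basis_full; exact: ltnW.
Qed.

Definition induced_coef_aug : {linear marked_mod alpha N (induced_mod 0) -> coefs} :=
  block_aug (fun a : cut_basis 0 => induced_aug (delta (val a) 1)).

Lemma induced_coef_aug_d x : induced_coef_aug (induced_d 0 x) = 0.
Proof.
rewrite [LHS]block_aug_rmul big1 // => a _.
set s := \sum_i _; suff -> : s = induced_aug (bc_d E 0 (delta (val a) 1)).
  by rewrite induced_aug_d scaler0.
rewrite [RHS](congr1 induced_aug (freemod_expand _ (fun i => cut_basis_full i (leq0n _)))).
rewrite linear_sum; apply: eq_bigr => i _.
by rewrite linearZ_LR trivial_mod_scale.
Qed.

Definition chain_transfer k : C k -> marked_mod alpha N (induced_mod k) :=
  transfer N mY YK (f k) (cut_basis k).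

Lemma chain_transfer_aug x :
  induced_coef_aug (chain_transfer x) = (int_aug x)%:~R.
Proof.
apply: (transfer_aug N mY YK finK Ycover Ydisj (eps := int_aug (C := C)) (e := induced_aug)
  (f := f 0%N) (B := cut_basis 0)).
- by move=> a; exact: cut_basis_full.
- exact: induced_aug_f.
move=> h y; rewrite /int_aug linearZ_LR.
by rewrite [LHS]trivial_mod_monomial mul1r.
Qed.

Lemma induced_coef_aug_surj y : exists x, induced_coef_aug x = y.
Proof.
have [c c1] := fr_aug_surj C 1; exists ((delta 1%g y : CR) *: chain_transfer c).
rewrite linearZ_LR chain_transfer_aug [int_aug c]c1.
by rewrite [LHS]cp_scale_delta rmorph1 mulr1.
Qed.

Definition induced_complex : augmented_complex alpha N :=
  AugmentedComplex induced_dd induced_coef_aug_surj induced_coef_aug_d.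

Lemma chain_transfer_d k (x : C k.+1) : (k <= n)%N ->
  induced_d k (chain_transfer x) = chain_transfer (bc_d C k x).
Proof.
move=> kn; have [fc _ _ _] := retract.
apply: (@transfer_chain _ _ _ _ _ _ _ N _ _ mY YK _ _ (bc_d C k) _ _ (bc_d E k)
  (f k.+1) (f k)) => [a|y].
  exact: cut_basis_full.
exact: fc.
Qed.

Lemma group_ring_to_crossed_monomial h z :
  group_ring_to_crossed alpha N (monomial h z) = delta h (Lconst mu N z).
Proof. exact: crossed_map_delta. Qed.

Lemma group_ring_to_crossed1 h :
  group_ring_to_crossed alpha N (monomial h 1) = translation alpha N h.
Proof. by rewrite group_ring_to_crossed_monomial rmorph1. Qed.

Notation W k := (resmod (group_ring_to_crossed alpha N) (marked_mod alpha N (induced_mod k))).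

Lemma exists_transfer_ext k :
  exists Phi : {linear freemod (group_ring Z G) (bc_basis C k) -> W k},
    forall x, Phi (coef_change Z x) = chain_transfer x.
Proof.
pose phi : {additive freemod (group_ring int G) (bc_basis C k) -> W k} :=
  transfer N mY YK (f k) (cut_basis k).
apply: (exists_coef_ext (phi := phi)) => h x.
rewrite [LHS]transfer_translate //.
change (translation alpha N h *: phi x = group_ring_to_crossed alpha N (monomial h 1) *:
  (phi x : marked_mod alpha N (induced_mod k))).
by rewrite group_ring_to_crossed1.
Qed.

(** An arbitrary resolution with coefficients in [Z] is first compared with the
    one obtained from [C] by a change of coefficients, and then transferred. *)
Lemma induced_embeds (C' : free_resolution Z G) : embeds C' n induced_complex.
Proof.
have [psi [psi_aug psi_d]] := exists_comparison C C'.
pose Phi k := sval (cid (exists_transfer_ext k)).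
have PhiE k x : Phi k (coef_change Z x) = chain_transfer x.
  exact: svalP (cid (exists_transfer_ext k)) x.
exists (fun k => Phi k \o psi k); split=> [x|k kn x] /=.
  rewrite -psi_aug; elim/coef_change_ind: (psi 0%N x) => [|u v IHu IHv|z u].
  - by rewrite !raddf0.
  - by rewrite !raddfD /= IHu IHv.
  rewrite !linearZ_LR PhiE base_change_augE.
  transitivity ((delta 1%g (Lconst mu N z) : CR) *: ((int_aug u)%:~R : coefs)).
    by rewrite -chain_transfer_aug -group_ring_to_crossed_monomial.
  have -> : monomial 1%g z *: ((int_aug u)%:~R : trivial_mod Z G) = (z * (int_aug u)%:~R : Z).
    exact: trivial_mod_monomial.
  by rewrite [LHS]cp_scale_delta rmorphM !rmorph_int.
have : @res_map _ _ (group_ring_to_crossed alpha N) _ _ (induced_d k) \o Phi k.+1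
    =1 Phi k \o base_change_d Z C k.
  apply: coef_change_linear_eq => y.
  change (induced_d k (Phi k.+1 (coef_change Z y)) =
    Phi k (base_change_d Z C k (coef_change Z y))).
  by rewrite base_change_dE (PhiE k) (PhiE k.+1); exact: chain_transfer_d.
by move=> hPhi; rewrite -psi_d; exact: hPhi.
Qed.

End InducedComplex.

(** * Bounding the logarithmic norm *)

Section LogNormBound.
Variables (G : groupType) (d : measure_display) (X : measurableType d).
Variables (R : realType) (mu : probability X R) (alpha : free_pmp_action G mu).
Variables (Z : comPzRingType) (N : normed_ring R Z).
Local Open Scope ereal_scope.

Lemma opnorm_ge0 (U V : Type) (nU : U -> \bar R) (nV : V -> \bar R) (f : U -> V) :
  0 <= opnorm nU nV f.
Proof. by apply/ereal_infP => _ [c [c0 _] <-]; rewrite lee_fin. Qed.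

Lemma mdim_ge0 (M : marked X) : 0 <= mdim mu M.
Proof. exact: sume_ge0. Qed.

Lemma log_plus_ge0 (t : \bar R) : 0 <= log_plus t.
Proof. by rewrite le_max lexx orbT. Qed.

Lemma le_log_plus (s t : \bar R) : 0 <= s -> s <= t -> log_plus s <= log_plus t.
Proof.
move=> s0 st; rewrite /log_plus ge_max le_max [0 <= _]le_max lexx orbT andbT.
apply/orP; left; rewrite lee_lne // in_itv /= ?s0 ?leey ?andbT //.
exact: le_trans st.
Qed.

Variables (M M' : marked X) (f : {linear marked_mod alpha N M -> marked_mod alpha N M'}).

Lemma marked_rk_ge0 : 0 <= marked_rk f.
Proof. by apply/ereal_infP => _ [S _ <-]; exact: mdim_ge0. Qed.

Lemma whole_sub i : (mk_set (m := M) i `<=` mk_set (m := M) i)%classic.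
Proof. by []. Qed.

Definition whole : marked_summand M := MarkedSummand (@mk_measurable _ _ M) whole_sub.

Lemma whole_cover i :
  (\bigcup_(k in [set: unit]) ms_set (whole : marked_summand M) i = mk_set (m := M) i)%classic.
Proof. by apply/seteqP; split=> [x [_ _]|x] //; exists tt. Qed.

Lemma whole_disjoint (i : mk_idx M) :
  trivIset [set: unit] (fun=> ms_set whole i).
Proof. by move=> [] []. Qed.

(** The decomposition into a single summand shows that the logarithmic norm is at
    most [dim M] times the logarithm of the operator norm. *)
Lemma lognorm_le : lognorm f <= mdim mu M * log_plus (marked_opnorm f).
Proof.
apply: ge_ereal_inf; eexists.
  by exists (MarkedDecomposition (md_part := fun=> whole) whole_cover whole_disjoint).
rewrite /= big_const card_unit /= adde0 /lognorm' ge_min; apply/orP; left.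
apply: lee_pmul; rewrite ?mdim_ge0 ?log_plus_ge0 //.
apply: le_log_plus; first exact: opnorm_ge0.
apply: ereal_inf_le_tmp => _ [c [c0 cf] <-]; exists c => //.
by split=> // z; exact: (cf (summand_incl z)).
Qed.

End LogNormBound.

Lemma lognorm_ge0 (G : groupType) d (X : measurableType d) (R : realType)
    (mu : probability X R) (alpha : free_pmp_action G mu) (Z : comPzRingType)
    (N : normed_ring R Z) M M' (f : {linear marked_mod alpha N M -> marked_mod alpha N M'}) :
  (0 <= lognorm f)%E.
Proof.
apply/ereal_infP => _ [D ->]; apply: sume_ge0 => k _.
by rewrite le_min !mule_ge0 ?mdim_ge0 ?marked_rk_ge0 ?log_plus_ge0.
Qed.

(** With [T = exp u] and [exp u >= (1 + u / 2) ^ 2], the quotient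
    [(1 + ln T) / T] is at most [4 / u]. *)
Lemma exists_small_log_ratio (R : realType) (M eps : R) : 0 <= M -> 0 < eps ->
  exists T : R, 1 <= T /\ M * (1 + ln T) / T <= eps.
Proof.
move=> M0 e0; pose u := 4 * M / eps.
have u0 : 0 <= u by apply: divr_ge0; [apply: mulr_ge0|apply: ltW].
exists (expR u); split; first by rewrite -[1]expR0 ler_expR.
have T0 := expR_gt0 u; rewrite expRK ler_pdivrMr //.
have uT : 1 + u + u ^+ 2 / 4 <= expR u.
  have -> : 1 + u + u ^+ 2 / 4 = (1 + u / 2) ^+ 2 by field.
  have -> : expR u = expR (u / 2) ^+ 2 by rewrite -expRM_natl mulrC divfK.
  have h0 : 0 <= 1 + u / 2 by lra.
  by rewrite ler_sqr ?nnegrE ?expR_ge0 ?expR_ge1Dx.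
have -> : M = eps * u / 4 by rewrite /u; field; rewrite gt_eqF.
apply: (@le_trans _ _ (eps * (1 + u + u ^+ 2 / 4))); last by rewrite ler_pM2l.
rewrite -subr_ge0; have -> : eps * (1 + u + u ^+ 2 / 4) - eps * u / 4 * (1 + u) =
  eps * (1 + 3 / 4 * u) by field.
by apply: mulr_ge0; [apply: ltW|lra].
Qed.

(** * Cylinders in the profinite completion *)

Section Cylinder.
Variables (G : groupType) (L : residual_chain G) (i : nat).
Local Open Scope classical_set_scope.

Definition cylinder : set (pf_borel L) := [set x | x i = left_coset 1%g (L i)].

Lemma cylinder_measurable : measurable cylinder.
Proof. by apply: sub_sigma_algebra => x xi; exists i => y yx; rewrite /cylinder /= yx. Qed.

Lemma left_cosetP g h : left_coset g (L i) = left_coset h (L i) <-> (g^-1 * h)%g \in L i.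
Proof.
split=> [gh|]; last exact: left_coset_eq.
have : left_coset g (L i) h by rewrite gh; exists 1%g; [exact: gpred1|rewrite mulg1].
by case=> l /= lL <-; rewrite mulKg.
Qed.

Lemma cylinder_act g h (x : pf_borel L) : x i = left_coset h (L i) ->
  cylinder (pf_act g^-1%g x) <-> (g^-1 * h)%g \in L i.
Proof.
move=> xi; have E := pf_mul_cosetE (pf_diagE L g^-1%g i) xi.
change ((pf_mul (pf_diag L g^-1%g) x : profinite L) i = left_coset 1%g (L i) <->
  (g^-1 * h)%g \in L i).
by rewrite E left_cosetP mulg1 gpredV.
Qed.

Lemma cylinder_mem h (x : pf_borel L) : x i = left_coset h (L i) ->
  cylinder x <-> h \in L i.
Proof.
by move=> xi; have := cylinder_act 1%g xi; rewrite invg1 pf_act1 mul1g.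
Qed.

Lemma cylinder_invariant l : l \in L i ->
  (@pf_act G L l @^-1` cylinder) = cylinder.
Proof.
move=> lL; apply/seteqP; split=> x /=; have [h xi] := pf_repr x i.
  rewrite -{1}[l]invgK (cylinder_act _ xi) (cylinder_mem xi) invgK => lh.
  by rewrite -(mulKg l h) gpredM // gpredV.
rewrite -{1}[l]invgK (cylinder_act _ xi) (cylinder_mem xi) invgK => hL.
exact: gpredM.
Qed.

Lemma cylinder_cover (x : pf_borel L) : exists g, cylinder (pf_act g^-1%g x).
Proof.
have [h xi] := pf_repr x i; exists h; apply/(cylinder_act _ xi).
by rewrite mulVg gpred1.
Qed.

Lemma cylinder_disjoint (x : pf_borel L) g h :
  cylinder (pf_act g^-1%g x) -> cylinder (pf_act h^-1%g x) -> (g^-1 * h)%g \in L i.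
Proof.
have [k xi] := pf_repr x i; move=> /(cylinder_act _ xi) gk /(cylinder_act _ xi) hk.
have -> : (g^-1 * h = (g^-1 * k) * (h^-1 * k)^-1)%g.
  by rewrite invgM invgK mulgA mulgK.
by rewrite gpredM // gpredV.
Qed.

End Cylinder.

(** * Cheap rebuilding gives cheap embeddings *)

Section CheapEmbedding.
Variables (R : realType) (n : nat) (G : groupType).
Hypothesis hG : CERP R G n.+1.
Variables (L : residual_chain G) (mu : probability (pf_borel L) R) (haar : is_haar mu).
Variables (Z : comPzRingType) (N : normed_ring R Z).
Notation alpha := (profinite_completion haar).

(** In degree [r] the induced complex has dimension at most [kappa / T * s] with
    [s] the number of generators of the resolution, and the logarithm of the norm of
    its differential is at most [kappa * (1 + ln T)]; so [T] has to beat its own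
    logarithm. *)
Lemma cheap_embedding (C' : free_resolution Z G) (r : nat) (eps : R) :
  (r <= n.+1)%N -> 0 < eps ->
  exists D : augmented_complex alpha N,
    [/\ embeds C' n D, (mdim mu (D r) <= eps%:E)%E &
      forall k, k.+1 = r -> (lognorm (ac_d D k) <= eps%:E)%E].
Proof.
move=> rn e0; have [C [kappa [k1 fg reb]]] := hG.
have [s [gens gensP]] := fg r rn.
have k0 : 0 < kappa by apply: lt_le_trans k1.
(* This number, multiplied by [(1 + ln T) / T], bounds both quantities, because
   [1 <= kappa] and [0 <= ln T]. *)
have M0 : 0 <= kappa * kappa * s%:R by rewrite !mulr_ge0 // ltW.
have [T [T1 Teps]] := exists_small_log_ratio M0 e0.
have T0 : 0 < T by apply: lt_le_trans T1.
have lnT0 : 0 <= ln T by apply: ln_ge0.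
have [i0 /(_ i0 (leqnn _))] := reb T L T1.
set i := i0 => -[E [f [g [H [retract ranks dE _]]]]].
have finK : finite_set (cosets (L i)) by exact: rc_finite_index.
have mY := @cylinder_measurable G L i.
have YK : forall l, l \in L i -> (alpha l @^-1` cylinder i = cylinder i)%classic.
  by move=> l lL; exact: cylinder_invariant.
have Ycover : forall x, exists g, cylinder i (alpha g^-1%g x) by exact: cylinder_cover.
have Ydisj : forall x g h, cylinder i (alpha g^-1%g x) -> cylinder i (alpha h^-1%g x) ->
  (g^-1 * h)%g \in L i by exact: cylinder_disjoint.
have finE k : (k <= n.+1)%N -> finite_set [set: bc_basis E k]%classic.
  by move=> kn; have [p [q [rkE _ _]]] := ranks k kn; exact: (basis_leq_rank rkE).1.
pose D := induced_complex N mY YK finK Ycover Ydisj retract finE.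
have muY := measure_coset mY YK finK Ycover Ydisj.
have dimD : (mdim mu (D r) <= (kappa / T * s%:R)%:E)%E.
  have [p [q [rkE rkC pq]]] := ranks r rn.
  have qs : (q <= coset_index (L i) * s)%N by exact: restriction_rank gensP rkC.
  have [_ Bp] := basis_leq_rank rkE.
  move: muY; rewrite -[mu _]fineK ?fin_num_measure // -EFinM => -[muY].
  set m := fine _ in muY.
  have m0 : 0 <= m by apply: fine_ge0.
  have -> : mdim mu (D r) = (#|` cut_basis E n r|%:R * m)%:E.
    transitivity (\sum_(a : cut_basis E n r) m%:E)%E.
      by apply: eq_bigr => a _; rewrite /m fineK ?fin_num_measure.
    by rewrite sumEFin sumr_const cardfE mulr_natl.
  rewrite lee_fin /cut_basis rn.
  apply: (@le_trans _ _ (p%:R * m)); first by rewrite ler_wpM2r // ler_nat.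
  apply: (@le_trans _ _ (kappa / T * q%:R * m)); first by rewrite ler_wpM2r.
  rewrite -!mulrA ler_pM2l // ler_pM2l ?invr_gt0 //.
  apply: (@le_trans _ _ ((coset_index (L i) * s)%:R * m)).
    by rewrite ler_wpM2r // ler_nat.
  by rewrite natrM mulrAC muY mul1r.
have s0 : 0 <= s%:R :> R by [].
exists D; split.
- exact: induced_embeds.
- apply: le_trans dimD _; rewrite lee_fin; apply: le_trans Teps.
  have -> : kappa * kappa * s%:R * (1 + ln T) / T =
      kappa / T * s%:R * (kappa * (1 + ln T)) by ring.
  rewrite ler_peMr ?mulr_ge0 ?invr_ge0 ?(ltW k0) ?(ltW T0) //.
  have T1' : 1 <= 1 + ln T by lra.
  by apply: le_trans k1 _; rewrite ler_peMr // ltW.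
move=> k kr; apply: le_trans (lognorm_le _) _.
have kn : (k < n.+1)%N by rewrite kr.
have opd : (marked_opnorm (ac_d D k) <= (expR kappa * T `^ kappa)%:E)%E.
  apply: le_trans (dE k kn); apply: opnorm_rmul => a; apply: cut_basis_full => //.
  exact: ltnW.
have logd : (log_plus (marked_opnorm (ac_d D k)) <= (kappa * (1 + ln T))%:E)%E.
  apply: le_trans (le_log_plus (opnorm_ge0 _ _ _) opd) _.
  have pos : 0 < expR kappa * T `^ kappa by rewrite mulr_gt0 ?expR_gt0 ?powR_gt0.
  rewrite /log_plus lne_EFin // lnM ?posrE ?expR_gt0 ?powR_gt0 // expRK ln_powR.
  by rewrite ge_max !lee_fin mulrDr mulr1 lexx /= addr_ge0 ?mulr_ge0 ?(ltW k0).
rewrite -kr in dimD.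
apply: (@le_trans _ _ ((kappa / T * s%:R)%:E * (kappa * (1 + ln T))%:E)%E).
  by apply: lee_pmul; rewrite ?mdim_ge0 ?log_plus_ge0.
rewrite -EFinM lee_fin; apply: le_trans Teps.
rewrite le_eqVlt; apply/orP; left; apply/eqP; ring.
Qed.

End CheapEmbedding.

Theorem theorem14p7 (R : realType) (n : nat) (G : groupType)
    (hG : CERP R G n.+1)
    (L : residual_chain G)
    (mu : probability (pf_borel L) R) (haar : is_haar mu) :
  let alpha := profinite_completion haar in
  (forall (C : free_resolution int G) (r : nat), (r <= n.+1)%N ->
     medim alpha (int_norm R) C n r = 0%E) /\
  (forall (F : finFieldType) (C : free_resolution F G) (r : nat), (r <= n.+1)%N ->
     medim alpha (trivial_norm R F) C n r = 0%E) /\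
  (forall (C : free_resolution int G) (r : nat), (r <= n)%N ->
     mevol alpha (int_norm R) C r = 0%E).
Proof.
move=> alpha.
have medim0 (Z : comPzRingType) (N : normed_ring R Z) (C : free_resolution Z G) r :
    (r <= n.+1)%N -> medim alpha N C n r = 0%E.
  move=> rn; apply/eqP; rewrite eq_le; apply/andP; split.
    apply/lee_addgt0Pr => e e0; rewrite add0e.
    have [D [embD dimD _]] := cheap_embedding hG haar N C rn e0.
    rewrite /medim; case: leqP => rn'; apply: ge_ereal_inf; exists (mdim mu (D r)) => //.
      exists D => //; have [f [fa fd]] := embD; exists f; split=> // k kr.
      by apply: fd; exact: leq_trans rn'.
    by exists D => //; congr (mdim mu (D _)); apply/eqP; rewrite eqn_leq rn.
  by rewrite /medim; case: leqP => _; apply/ereal_infP => _ [D _ ->]; exact: mdim_ge0.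
split; first by move=> C r; exact: medim0.
split; first by move=> F C r; exact: medim0.
move=> C r rn; apply/eqP; rewrite eq_le; apply/andP; split; last first.
  by apply/ereal_infP => _ [D _ ->]; exact: lognorm_ge0.
apply/lee_addgt0Pr => e e0; rewrite add0e.
have rn1 : (r.+1 <= n.+1)%N by [].
have [D [embD _ lnD]] := cheap_embedding hG haar (int_norm R) C rn1 e0.
apply: ge_ereal_inf; exists (lognorm (ac_d D r)); last exact: lnD.
exists D => //; have [f [fa fd]] := embD; exists f; split=> // k kr.
by apply: fd; exact: leq_trans rn.
Qed.
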